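(* Let $d\ge1$, $L>0$, $N\ge 2$ an integer power of $2$, $T>0$, and let $(V_t)_{t\in[0,T]}$ be real-valued functions on $\mathbb{T}^d$ such that $t\mapsto V_t(x)$ is continuously differentiable on $[0,T]$ for every $x\in\mathbb{T}^d$. Let $H_t^c=i[K,D_{V_t}]$, and for $0\le t_0\le t_1\le T$ let $U(t_1,t_0)=\mathcal{T}\exp\!\big(-i\int_{t_0}^{t_1}H_t^c\,dt\big)$ be the time-ordered evolution. With $\Delta t=t_1-t_0$, $\alpha=\frac{L}{\pi N}\sqrt{\Delta t/d}$ and $\beta=\frac{\pi N}{2L}\sqrt{d\,\Delta t}$, define $$W(t_0)=e^{i\beta D_{V_{t_0}}}e^{i\alpha K}e^{-i\beta D_{V_{t_0}}}e^{-i\alpha K}e^{-i\beta D_{V_{t_0}}}e^{-i\alpha K}e^{i\beta D_{V_{t_0}}}e^{i\alpha K}.$$ Then, in spectral norm, $$\big\|U(t_1,t_0)-W(t_0)\big\|\le\Big[\frac{3\pi^4}{4}\frac{d^2N^4}{L^4}\big(1+\|V_{t_0}\|_{\mathsf{L}^\infty}\big)^4+\frac{\pi^2}{2}\frac{dN^2}{L^2}\max_{t\in[t_0,t_1]}\Big\|\frac{\partial}{\partial t}V_t\Big\|_{\mathsf{L}^\infty}\Big]\Delta t^2.$$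
   Context: $\mathbb{T}^d$ denotes the cube $[0,L]^d$ with opposite faces identified. $\mathbb{X}_N=\frac{L}{N}\{0,1,\dots,N-1\}$ and $\mathbb{X}_N^d\subset\mathbb{T}^d$ is the uniform grid of $N^d$ points. For $x=(x_1,\dots,x_d)\in\mathbb{X}_N^d$, $\ket{x}=\ket{x_1N/L}\otimes\cdots\otimes\ket{x_dN/L}\in\mathbb{C}^{N^d}$, where $\ket{j}$, $j\in\{0,\dots,N-1\}$, is the standard basis of $\mathbb{C}^N$. Define $N\times N$ matrices $F=\frac{1}{\sqrt N}\sum_{j,\ell=0}^{N-1}e^{2\pi i j\ell/N}\ket{j}\!\bra{\ell}$, $S=\sum_{j=0}^{N-1}(-1)^j\ket{j}\!\bra{j}$, $D_K=(2\pi/L)^2\sum_{j=0}^{N-1}(j-N/2)^2\ket{j}\!\bra{j}$, and the $N^d\times N^d$ matrix $K=\frac12\big(SFD_KF^\dagger S^\dagger\big)^{\oplus d}$, where $M^{\oplus d}=\sum_{j=1}^d I^{\otimes(j-1)}\otimes M\otimes I^{\otimes(d-j)}$ is the $d$-fold Kronecker sum. For a function $V$ on $\mathbb{T}^d$, $D_V=\sum_{x\in\mathbb{X}_N^d}V(x)\ket{x}\!\bra{x}$. $\|f\|_{\mathsf{L}^\infty}=\max_{x\in\mathbb{T}^d}|f(x)|$. *)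

(* Defs.v *)
From HB Require Import structures.
From mathcomp Require Import all_boot all_order all_algebra.
From mathcomp Require Import all_classical all_reals all_analysis.
From mathcomp Require Import complex mxtens.
Set Implicit Arguments.
Unset Strict Implicit.
Unset Printing Implicit Defensive.
Import Order.TTheory GRing.Theory Num.Theory.
Import numFieldNormedType.Exports.
Local Open Scope ring_scope.
Local Open Scope classical_set_scope.

(* The complex numbers over a real type R, packaged as a numClosedFieldType so
   that MathComp-Analysis equips it (and matrices over it) with its topology. *)
Definition Cc (R : realType) : numClosedFieldType := R[i].

Section Defs.
Variable R : realType.
Local Notation C := (Cc R).

Definition rc (x : R) : C := (x%:C)%C.
Definition iC : C := ('i)%C.
Definition expi (theta : R) : C := (cos theta +i* sin theta)%C.

Definition adjmx m n (A : 'M[C]_(m, n)) : 'M[C]_(n, m) :=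
  (map_mx (fun z : C => (conjc z : C)) A)^T.

Definition mexp n (A : 'M[C]_n) : 'M[C]_n :=
  limn (series (fun k : nat => (k`!%:R : C)^-1 *: A ^+ k)).

Definition vnorm n (v : 'cV[C]_n) : R :=
  Num.sqrt (\sum_(i < n) (complex.Re (v i 0 : R[i]) ^+ 2 + complex.Im (v i 0 : R[i]) ^+ 2)).
Definition specnorm m n (A : 'M[C]_(m, n)) : R :=
  sup [set vnorm (A *m v) | v in [set v : 'cV[C]_n | vnorm v = 1]].

Definition Fmat N : 'M[C]_N :=
  \matrix_(j < N, l < N)
     ((rc (Num.sqrt N%:R))^-1 * expi (2 * pi * j%:R * l%:R / N%:R)).
Definition Smat N : 'M[C]_N := diag_mx (\row_(j < N) ((-1) ^+ j : C)).
Definition DKmat N (L : R) : 'M[C]_N :=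
  diag_mx (\row_(j < N) rc ((2 * pi / L) ^+ 2 * (j%:R - N%:R / 2) ^+ 2)).

Lemma kron_dim (d N : nat) (j : 'I_d) : (N ^ j * N * N ^ (d.-1 - j) = N ^ d)%N.
Proof.
rewrite -expnSr -expnD; case: j => j /= lt_jd.
by case: d lt_jd => // d lt_jd /=; rewrite addSn subnKC.
Qed.

Definition kron_sum (d N : nat) (M : 'M[C]_N) : 'M[C]_(N ^ d) :=
  \sum_(j < d) castmx (kron_dim N j, kron_dim N j)
     (((1%:M : 'M[C]_(N ^ j)) *t M) *t (1%:M : 'M[C]_(N ^ (d.-1 - j)))).

Definition Kmat (d N : nat) (L : R) : 'M[C]_(N ^ d) :=
  (rc (1 / 2)) *: kron_sum d
     (Smat N *m Fmat N *m DKmat N L *m adjmx (Fmat N) *m adjmx (Smat N)).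

(* The grid point x in X_N^d with |x> = e_a ; the j-th digit (base N,
   most significant first, matching the Kronecker ordering) of a is x_j N/L. *)
Definition gridpt (d N : nat) (L : R) (a : 'I_(N ^ d)) : 'rV[R]_d :=
  \row_(j < d) (L / N%:R * ((a %/ N ^ (d.-1 - j)) %% N)%:R).

Definition DV (d N : nat) (L : R) (f : 'rV[R]_d -> R) : 'M[C]_(N ^ d) :=
  diag_mx (\row_(a < N ^ d) rc (f (gridpt L a))).

Definition torus (d : nat) (L : R) : set 'rV[R]_d :=
  [set x | forall j : 'I_d, 0 <= x 0 j < L].

Definition linf (d : nat) (L : R) (f : 'rV[R]_d -> R) : \bar R :=
  ereal_sup [set (`|f x|)%:E | x in @torus d L].

Definition Hc (d N : nat) (L : R) (f : 'rV[R]_d -> R) : 'M[C]_(N ^ d) :=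
  iC *: (Kmat d N L *m DV N L f - DV N L f *m Kmat d N L).

End Defs.

Arguments torus {R} d L _.
Arguments iC {R}.

(* Main.v *)
Require Import Defs.
From HB Require Import structures.
From mathcomp Require Import all_boot all_order all_algebra.
From mathcomp Require Import all_classical all_reals all_analysis.
From mathcomp Require Import complex mxtens.
Import Order.TTheory GRing.Theory Num.Theory.
Import numFieldNormedType.Exports.
Local Open Scope ring_scope.
Local Open Scope classical_set_scope.
From mathcomp Require Import ring lra.
Set Implicit Arguments.
Unset Strict Implicit.
Unset Printing Implicit Defensive.

(* Write A = i alpha K, B = i beta D and X = 2(BA - AB), so that X = dt [K, D] is
   the generator frozen at t0 times dt.  All matrices A, B, X, -i H_t are
   skew-Hermitian, hence their exponentials and U are unitary.

   Product formula.  For skew-Hermitian M with |M| <= c, diagonalizing M reduces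
   to the scalar bound |exp(ix) - sum_(j<k) (ix)^j/j!| <= |x|^k/k!, so exp M is
   within c^k/k! of its k-th Taylor polynomial for every k.  This property is
   stable under products (the radii c add up), so W is within (4c)^4/4! of its
   third Taylor polynomial, with c = |A| + |B|.  Writing W = Q(s)Q(-s)Q(-s)Q(s) at
   s = 1 with Q(s) = e^(sB) e^(sA), the odd terms cancel and that polynomial is
   exactly 1 + X.  As |X| <= 4|A||B| <= c^2, also |exp X - 1 - X| <= c^4/2, and
   256/24 + 1/2 <= 12.  Finally |A| <= beta and |B| <= beta |V|, which
   turns 12 c^4 into the first term of the bound.

   Freezing the generator.  Y_t = exp(-(t - t0)[K,D]) U_t satisfies
   |Y'_t| <= |[K, D_t - D]| <= 2|K| (t - t0) max|dV|, and the mean value inequality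
   gives the second term since |K| <= d pi^2 N^2 / (2 L^2). *)

(** * Vector and operator norms *)

Section VectorNorm.
Variable R : realType.
Local Notation C := (Cc R).
Local Notation re z := (complex.Re ((z : C) : R[i])).
Local Notation im z := (complex.Im ((z : C) : R[i])).
Local Notation nrm z := (Normc.normc ((z : C) : R[i])).

Lemma reD (x y : C) : re (x + y) = re x + re y. Proof. by case: x y => a b []. Qed.
Lemma imD (x y : C) : im (x + y) = im x + im y. Proof. by case: x y => a b []. Qed.
Lemma reN (x : C) : re (- x) = - re x. Proof. by case: x. Qed.
Lemma imN (x : C) : im (- x) = - im x. Proof. by case: x. Qed.
Lemma reM (x y : C) : re (x * y) = re x * re y - im x * im y.
Proof. by case: x y => a b []. Qed.
Lemma imM (x y : C) : im (x * y) = re x * im y + im x * re y.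
Proof. by case: x y => a b []. Qed.
Lemma reJ (x : C) : re (conjc x) = re x. Proof. by case: x. Qed.
Lemma imJ (x : C) : im (conjc x) = - im x. Proof. by case: x. Qed.
Lemma re_sum (I : Type) (s : seq I) (P : pred I) (F : I -> C) :
  re (\sum_(i <- s | P i) F i) = \sum_(i <- s | P i) re (F i).
Proof. exact: (big_morph (fun z : C => re z) reD). Qed.
Lemma im_sum (I : Type) (s : seq I) (P : pred I) (F : I -> C) :
  im (\sum_(i <- s | P i) F i) = \sum_(i <- s | P i) im (F i).
Proof. exact: (big_morph (fun z : C => im z) imD). Qed.

Lemma complex_eqP (x y : C) : re x = re y -> im x = im y -> x = y.
Proof. by case: x y => a b [c d] /= -> ->. Qed.

Lemma nrmE (z : C) : nrm z = Num.sqrt (re z ^+ 2 + im z ^+ 2).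
Proof. by case: z. Qed.

Lemma sqr_nrm (z : C) : nrm z ^+ 2 = re z ^+ 2 + im z ^+ 2.
Proof. by rewrite nrmE sqr_sqrtr // addr_ge0 // sqr_ge0. Qed.

Lemma nrm_ge0 (z : C) : 0 <= nrm z. Proof. by rewrite nrmE sqrtr_ge0. Qed.

Lemma nrmN (z : C) : nrm (- z) = nrm z.
Proof. by rewrite !nrmE reN imN !sqrrN. Qed.

Lemma nrm_rc (x : R) : nrm (rc x) = `|x|.
Proof. by rewrite nrmE /= expr0n /= addr0 sqrtr_sqr. Qed.

Lemma nrm_iC : nrm (iC : C) = 1.
Proof. by rewrite nrmE /= expr0n /= add0r expr1n sqrtr1. Qed.

Lemma rc_is_monoid_morphism : monoid_morphism (@rc R).
Proof. by split=> // x y; rewrite /rc rmorphM. Qed.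
Lemma rc_is_zmod_morphism : zmod_morphism (@rc R).
Proof. by move=> x y; rewrite /rc rmorphB. Qed.
HB.instance Definition _ := GRing.isZmodMorphism.Build R C (@rc R) rc_is_zmod_morphism.
HB.instance Definition _ := GRing.isMonoidMorphism.Build R C (@rc R) rc_is_monoid_morphism.

(** The real part of the Hermitian inner product, that is, the Euclidean inner product of C^n seen
    as R^(2n). Being real-valued, it is accessible to the mean value theorem. *)
Definition redot n (u v : 'cV[C]_n) : R :=
  \sum_(i < n) (re (u i 0) * re (v i 0) + im (u i 0) * im (v i 0)).

Lemma redotC n (u v : 'cV[C]_n) : redot u v = redot v u.
Proof. by apply: eq_bigr => i _; rewrite mulrC [im _ * _]mulrC. Qed.

Lemma redotDr n (u v w : 'cV[C]_n) : redot u (v + w) = redot u v + redot u w.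
Proof.
rewrite -big_split; apply: eq_bigr => i _ /=.
by rewrite mxE reD imD !mulrDr addrACA.
Qed.

Lemma redotNr n (u v : 'cV[C]_n) : redot u (- v) = - redot u v.
Proof.
rewrite -sumrN; apply: eq_bigr => i _ /=.
by rewrite mxE reN imN !mulrN opprD.
Qed.

Lemma redotBr n (u v w : 'cV[C]_n) : redot u (v - w) = redot u v - redot u w.
Proof. by rewrite redotDr redotNr. Qed.

Lemma redotZr n (a : R) (u v : 'cV[C]_n) : redot u (rc a *: v) = a * redot u v.
Proof.
rewrite big_distrr; apply: eq_bigr => i _ /=.
by rewrite mxE reM imM /= !mul0r subr0 addr0 mulrDr; congr (_ + _); rewrite mulrCA.
Qed.

Lemma redot_ge0 n (v : 'cV[C]_n) : 0 <= redot v v.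
Proof. by apply: sumr_ge0 => i _; rewrite -!expr2 addr_ge0 // sqr_ge0. Qed.

Lemma vnormE n (v : 'cV[C]_n) : vnorm v = Num.sqrt (redot v v).
Proof. by []. Qed.

Lemma vnorm_ge0 n (v : 'cV[C]_n) : 0 <= vnorm v.
Proof. exact: sqrtr_ge0. Qed.

Lemma sqr_vnorm n (v : 'cV[C]_n) : vnorm v ^+ 2 = redot v v.
Proof. by rewrite vnormE sqr_sqrtr // redot_ge0. Qed.

Lemma vnorm0 n : vnorm (0 : 'cV[C]_n) = 0.
Proof.
by rewrite /vnorm big1 ?sqrtr0 // => i _; rewrite mxE /= expr0n /= addr0.
Qed.

Lemma vnorm_eq0 n (v : 'cV[C]_n) : vnorm v = 0 -> v = 0.
Proof.
move=> v0; have := sqr_vnorm v; rewrite v0 expr0n /= => /esym /eqP.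
rewrite psumr_eq0 => [/allP v_0|i _]; last by rewrite -!expr2 addr_ge0 // sqr_ge0.
apply/matrixP => i j; rewrite ord1 mxE.
have /eqP := v_0 i (mem_index_enum _).
rewrite -!expr2 => /eqP; rewrite paddr_eq0 ?sqr_ge0 // !sqrf_eq0 => /andP[/eqP x0 /eqP y0].
exact: complex_eqP.
Qed.

(** Cauchy-Schwarz: the square of the norm of [|u| v - |v| u] expands to
    [2 |u| |v| (|u| |v| - <u, v>)], and the first factor is positive once the two zero cases are
    removed. *)
Lemma redot_le n (u v : 'cV[C]_n) : redot u v <= vnorm u * vnorm v.
Proof.
have [u0|u_neq0] := eqVneq (vnorm u) 0.
  rewrite u0 mul0r (vnorm_eq0 u0) redotC.
  have -> : (0 : 'cV[C]_n) = rc 0 *: 0 by rewrite scaler0.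
  by rewrite redotZr mul0r.
have [v0|v_neq0] := eqVneq (vnorm v) 0.
  rewrite v0 mulr0 (vnorm_eq0 v0).
  have -> : (0 : 'cV[C]_n) = rc 0 *: 0 by rewrite scaler0.
  by rewrite redotZr mul0r.
have uv_gt0 : 0 < vnorm u * vnorm v by rewrite mulr_gt0 // lt0r ?u_neq0 ?v_neq0 vnorm_ge0.
rewrite -(ler_pM2l uv_gt0) -subr_ge0.
have := redot_ge0 (rc (vnorm u) *: v - rc (vnorm v) *: u).
rewrite redotBr !(redotC (_ - _)) !redotBr !redotZr ![redot (_ *: _) _]redotC !redotZr.
rewrite -!sqr_vnorm (redotC v u).
rewrite [X in 0 <= X](_ : _ = 2 * (vnorm u * vnorm v * (vnorm u * vnorm v)
  - vnorm u * vnorm v * redot u v)).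
  by rewrite pmulr_rge0.
by ring.
Qed.

Lemma vnormD n (u v : 'cV[C]_n) : vnorm (u + v) <= vnorm u + vnorm v.
Proof.
rewrite -(@ler_pXn2r _ 2) ?nnegrE ?addr_ge0 ?vnorm_ge0 //.
rewrite sqr_vnorm redotDr !(redotC (_ + _)) !redotDr -!sqr_vnorm.
have := redot_le u v; rewrite (redotC v u); move: (redot u v) => x; nra.
Qed.

Lemma vnormZ n (z : C) (v : 'cV[C]_n) : vnorm (z *: v) = nrm z * vnorm v.
Proof.
rewrite nrmE /vnorm -sqrtrM ?addr_ge0 ?sqr_ge0 //; congr Num.sqrt.
rewrite big_distrr; apply: eq_bigr => i _ /=.
by rewrite mxE reM imM; ring.
Qed.

Lemma nrm_entry_le n (v : 'cV[C]_n) i : nrm (v i 0) <= vnorm v.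
Proof.
rewrite nrmE /vnorm ler_sqrt; last first.
  by apply: sumr_ge0 => j _; rewrite addr_ge0 // sqr_ge0.
by rewrite (bigD1 i) //= lerDl sumr_ge0 // => j _; rewrite addr_ge0 // sqr_ge0.
Qed.

Lemma vnorm_delta n (i : 'I_n) : vnorm (delta_mx i 0 : 'cV[C]_n) = 1.
Proof.
rewrite /vnorm (bigD1 i) //= big1 => [|j ji]; rewrite !mxE ?eqxx /=.
  by rewrite expr1n expr0n /= !addr0 sqrtr1.
by rewrite (negbTE ji) /= expr0n /= addr0.
Qed.

Lemma adjmxM m n p (A : 'M[C]_(m, n)) (B : 'M[C]_(n, p)) :
  adjmx (A *m B) = adjmx B *m adjmx A.
Proof.
apply/matrixP => i j; rewrite !mxE.
rewrite (big_morph (fun z : C => (conjc z : C)) (rmorphD _) (rmorph0 _)).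
by apply: eq_bigr => k _; rewrite !mxE rmorphM mulrC.
Qed.

Lemma adjmxK m n (A : 'M[C]_(m, n)) : adjmx (adjmx A) = A.
Proof. by apply/matrixP => i j; rewrite !mxE conjcK. Qed.

Lemma adjmxD m n (A B : 'M[C]_(m, n)) : adjmx (A + B) = adjmx A + adjmx B.
Proof. by apply/matrixP => i j; rewrite !mxE rmorphD. Qed.

Lemma adjmxN m n (A : 'M[C]_(m, n)) : adjmx (- A) = - adjmx A.
Proof. by apply/matrixP => i j; rewrite !mxE rmorphN. Qed.

Lemma adjmx_sum m n (I : Type) (s : seq I) (F : I -> 'M[C]_(m, n)) :
  adjmx (\sum_(i <- s) F i) = \sum_(i <- s) adjmx (F i).
Proof.
apply: (big_morph _ (@adjmxD _ _)).
by apply/matrixP => i j; rewrite !mxE conjc0.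
Qed.

Lemma adjmxZ m n (z : C) (A : 'M[C]_(m, n)) : adjmx (z *: A) = (conjc z : C) *: adjmx A.
Proof. by apply/matrixP => i j; rewrite !mxE rmorphM. Qed.

Lemma adjmx1 n : adjmx (1%:M : 'M[C]_n) = 1%:M.
Proof. by apply/matrixP => i j; rewrite !mxE eq_sym rmorph_nat. Qed.

Lemma adjmx_diag n (d : 'rV[C]_n) :
  adjmx (diag_mx d) = diag_mx (map_mx (fun z : C => (conjc z : C)) d).
Proof.
apply/matrixP => i j; rewrite !mxE eq_sym; case: eqP => [->|_]; rewrite ?mulr1n //.
by rewrite !mulr0n conjc0.
Qed.

Lemma redotE n (u v : 'cV[C]_n) : redot u v = re ((adjmx u *m v) 0 0).
Proof.
rewrite mxE re_sum; apply: eq_bigr => i _.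
by rewrite !mxE reM reJ imJ mulNr opprK.
Qed.

Lemma redot_adj m n (A : 'M[C]_(m, n)) u v : redot (A *m u) v = redot u (adjmx A *m v).
Proof. by rewrite !redotE adjmxM mulmxA. Qed.

Lemma vnorm_isometry m n (Q : 'M[C]_(m, n)) v :
  adjmx Q *m Q = 1%:M -> vnorm (Q *m v) = vnorm v.
Proof. by move=> QQ; rewrite !vnormE redot_adj mulmxA QQ mul1mx. Qed.

(** Bounds in this form add and multiply without handling the supremum in [specnorm]; the passage to
    [specnorm] takes place once, through [specnorm_le]. *)
Definition opbound m n (A : 'M[C]_(m, n)) (c : R) :=
  forall v, vnorm (A *m v) <= c * vnorm v.

Lemma opbound_le m n (A : 'M[C]_(m, n)) a b : a <= b -> opbound A a -> opbound A b.
Proof. by move=> ab Aa v; rewrite (le_trans (Aa v)) // ler_wpM2r // vnorm_ge0. Qed.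

Lemma opbound0 m n : opbound (0 : 'M[C]_(m, n)) 0.
Proof. by move=> v; rewrite mul0mx vnorm0 mul0r. Qed.

Lemma opboundD m n (A B : 'M[C]_(m, n)) a b :
  opbound A a -> opbound B b -> opbound (A + B) (a + b).
Proof.
move=> Aa Bb v; rewrite mulmxDl mulrDl.
by rewrite (le_trans (vnormD _ _)) // lerD.
Qed.

Lemma opboundZ m n z (A : 'M[C]_(m, n)) a : opbound A a -> opbound (z *: A) (nrm z * a).
Proof. by move=> Aa v; rewrite -scalemxAl vnormZ -mulrA ler_wpM2l // nrm_ge0. Qed.

Lemma opboundN m n (A : 'M[C]_(m, n)) a : opbound A a -> opbound (- A) a.
Proof.
move=> Aa; rewrite -scaleN1r; have := opboundZ (-1) Aa.
by rewrite nrmN Normc.normc1 mul1r.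
Qed.

Lemma opboundB m n (A B : 'M[C]_(m, n)) a b :
  opbound A a -> opbound B b -> opbound (A - B) (a + b).
Proof. by move=> Aa Bb; apply: opboundD => //; apply: opboundN. Qed.

Lemma opbound_sum m n (I : Type) (s : seq I) (F : I -> 'M[C]_(m, n)) c :
  (forall i, opbound (F i) (c i)) -> opbound (\sum_(i <- s) F i) (\sum_(i <- s) c i).
Proof.
move=> Fc; elim: s => [|x s IH]; first by rewrite !big_nil; apply: opbound0.
by rewrite !big_cons; apply: opboundD.
Qed.

Lemma opboundM m n p (A : 'M[C]_(m, n)) (B : 'M[C]_(n, p)) a b : 0 <= a ->
  opbound A a -> opbound B b -> opbound (A *m B) (a * b).
Proof.
move=> a0 Aa Bb v; rewrite -mulmxA (le_trans (Aa _)) // -mulrA.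
by rewrite ler_wpM2l.
Qed.

Lemma opbound_isometry m n (Q : 'M[C]_(m, n)) : adjmx Q *m Q = 1%:M -> opbound Q 1.
Proof. by move=> QQ v; rewrite vnorm_isometry // mul1r. Qed.

Lemma opbound_diag n (d : 'rV[C]_n) c : (forall i, nrm (d 0 i) <= c) ->
  opbound (diag_mx d) c.
Proof.
(* The sign of [c] is read off an entry of [d], so dimension 0 is treated apart. *)
case: n d => [|n] d dc v.
  by rewrite (flatmx0 v) mulmx0 vnorm0 mulr0.
have c0 : 0 <= c := le_trans (nrm_ge0 _) (dc 0).
rewrite -(@ler_pXn2r _ 2) ?nnegrE ?mulr_ge0 ?vnorm_ge0 //.
rewrite exprMn !sqr_vnorm mul_diag_mx big_distrr; apply: ler_sum => i _ /=.
rewrite !mxE -!expr2 -!sqr_nrm Normc.normcM exprMn ler_wpM2r ?sqr_ge0 //.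
by rewrite ler_pXn2r ?nnegrE ?nrm_ge0.
Qed.

Lemma opbound_entry m n (A : 'M[C]_(m, n)) a i j : opbound A a -> nrm (A i j) <= a.
Proof.
move=> /(_ (delta_mx j 0)); rewrite vnorm_delta mulr1; apply: le_trans.
by rewrite -colE; have := nrm_entry_le (col j A) i; rewrite mxE.
Qed.

(** Positive dimension provides a unit vector, so the supremum is over a nonempty set. *)
Lemma specnorm_le m n (A : 'M[C]_(m, n)) a : (0 < n)%N -> opbound A a -> specnorm A <= a.
Proof.
case: n A => // n A _ Aa; apply: ge_sup.
  by exists (vnorm (A *m delta_mx 0 0)); exists (delta_mx 0 0) => //; apply: vnorm_delta.
by move=> _ [v /= v1 <-]; rewrite (le_trans (Aa v)) // v1 mulr1.
Qed.

End VectorNorm.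

(** * Complex-valued calculus and the scalar exponential *)

Section ComplexCalculus.
Variable R : realType.
Local Notation C := (Cc R).
Local Notation re z := (complex.Re ((z : C) : R[i])).
Local Notation im z := (complex.Im ((z : C) : R[i])).
Local Notation nrm z := (Normc.normc ((z : C) : R[i])).

(** Splitting into real and imaginary parts reduces everything to real calculus; [mder] and [mcont]
    then work entry by entry. *)
Definition cder (f : R -> C) (t : R) (l : C) :=
  is_derive t 1 (fun s => re (f s)) (re l) /\ is_derive t 1 (fun s => im (f s)) (im l).

Definition ccont (D : set R) (f : R -> C) :=
  {within D, continuous (fun s => re (f s))} /\ {within D, continuous (fun s => im (f s))}.

(* The library states [is_deriveD] and its companions for sums and products in the
   ring of functions; the versions below are stated for explicit lambda-terms. *)
Lemma is_derive_conv (f : R -> R) (t d d' : R) :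
  is_derive t 1 f d -> d = d' -> is_derive t 1 f d'.
Proof. by move=> fd <-. Qed.

Lemma is_derive_add (f g : R -> R) (t df dg : R) : is_derive t 1 f df -> is_derive t 1 g dg ->
  is_derive t 1 (fun s => f s + g s) (df + dg).
Proof. by move=> ? ?; exact: (is_deriveD). Qed.

Lemma is_derive_mul (f g : R -> R) (t df dg : R) : is_derive t 1 f df -> is_derive t 1 g dg ->
  is_derive t 1 (fun s => f s * g s) (f t * dg + g t * df).
Proof. by move=> ? ?; exact: (is_deriveM). Qed.

Lemma is_derive_opp (f : R -> R) (t df : R) : is_derive t 1 f df ->
  is_derive t 1 (fun s => - f s) (- df).
Proof. by move=> ?; exact: (is_deriveN). Qed.

Lemma is_derive_big (I : Type) (s : seq I) (f : I -> R -> R) (t : R) (df : I -> R) :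
  (forall i, is_derive t 1 (f i) (df i)) ->
  is_derive t 1 (fun x => \sum_(i <- s) f i x) (\sum_(i <- s) df i).
Proof.
move=> fd; elim: s => [|i s IH].
  by under eq_fun do rewrite big_nil; rewrite big_nil; exact: is_derive_cst.
by under eq_fun do rewrite big_cons; rewrite big_cons; exact: is_derive_add.
Qed.

Lemma within_big (I : Type) (s : seq I) (f : I -> R -> R) D :
  (forall i, {within D, continuous (f i)}) ->
  {within D, continuous (fun x => \sum_(i <- s) f i x)}.
Proof.
move=> fd; elim: s => [|i s IH].
  by under eq_fun do rewrite big_nil; move=> x; exact: cvg_cst.
under eq_fun do rewrite big_cons.
by move=> x; apply: cvgD; [exact: fd|exact: IH].
Qed.

Lemma cderM f g t (df dg : C) : cder f t df -> cder g t dg ->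
  cder (fun s => f s * g s) t (df * g t + f t * dg).
Proof.
move=> [f1 f2] [g1 g2]; split.
  under eq_fun do rewrite reM.
  apply: (is_derive_conv (is_derive_add (is_derive_mul f1 g1)
    (is_derive_opp (is_derive_mul f2 g2)))).
  by rewrite reD !reM; ring.
under eq_fun do rewrite imM.
apply: (is_derive_conv (is_derive_add (is_derive_mul f1 g2) (is_derive_mul f2 g1))).
by rewrite imD !imM; ring.
Qed.

Lemma ccontM f g D : ccont D f -> ccont D g -> ccont D (fun s => f s * g s).
Proof.
move=> [f1 f2] [g1 g2]; split.
  under eq_fun do rewrite reM.
  by move=> x; apply: cvgB; apply: cvgM; [exact: f1|exact: g1|exact: f2|exact: g2].
under eq_fun do rewrite imM.
by move=> x; apply: cvgD; apply: cvgM; [exact: f1|exact: g2|exact: f2|exact: g1].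
Qed.

Lemma cder_cst (c : C) t : cder (fun _ => c) t 0.
Proof. by split; exact: is_derive_cst. Qed.

Lemma ccont_cst (c : C) D : ccont D (fun _ => c).
Proof. by split => x; exact: cvg_cst. Qed.

Lemma cder_ccont f df D : (forall t, cder f t (df t)) -> ccont D f.
Proof.
move=> fd; split; apply: continuous_subspaceT => t; apply: differentiable_continuous;
  apply/derivable1_diffP; by have [[? _] [? _]] := fd t.
Qed.

Definition mder m n (A : R -> 'M[C]_(m, n)) (t : R) (B : 'M[C]_(m, n)) :=
  forall i j, cder (fun s => A s i j) t (B i j).

Definition mcont m n (D : set R) (A : R -> 'M[C]_(m, n)) :=
  forall i j, ccont D (fun s => A s i j).

Lemma mderM m n p (A : R -> 'M[C]_(m, n)) (B : R -> 'M[C]_(n, p)) t dA dB :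
  mder A t dA -> mder B t dB -> mder (fun s => A s *m B s) t (dA *m B t + A t *m dB).
Proof.
move=> Ad Bd i j; rewrite !mxE -big_split /=; under eq_fun do rewrite mxE.
have AB k := cderM (Ad i k) (Bd k j).
split.
  under eq_fun do rewrite re_sum; rewrite re_sum.
  by apply: is_derive_big => k; case: (AB k).
under eq_fun do rewrite im_sum; rewrite im_sum.
by apply: is_derive_big => k; case: (AB k).
Qed.

Lemma mcontM m n p (A : R -> 'M[C]_(m, n)) (B : R -> 'M[C]_(n, p)) D :
  mcont D A -> mcont D B -> mcont D (fun s => A s *m B s).
Proof.
move=> Ad Bd i j; under eq_fun do rewrite mxE.
have AB k := ccontM (Ad i k) (Bd k j).
split.
  under eq_fun do rewrite re_sum.
  by apply: within_big => k; case: (AB k).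
under eq_fun do rewrite im_sum.
by apply: within_big => k; case: (AB k).
Qed.

Lemma mder_cst m n (A : 'M[C]_(m, n)) t : mder (fun _ => A) t 0.
Proof. by move=> i j; rewrite mxE; exact: cder_cst. Qed.

Lemma mcont_cst m n (A : 'M[C]_(m, n)) D : mcont D (fun _ => A).
Proof. by move=> i j; exact: ccont_cst. Qed.

Lemma mder_adj m n (A : R -> 'M[C]_(m, n)) t dA :
  mder A t dA -> mder (fun s => adjmx (A s)) t (adjmx dA).
Proof.
move=> Ad i j; under eq_fun do rewrite !mxE; rewrite !mxE.
have [A1 A2] := Ad j i; split.
  by under eq_fun do rewrite reJ; rewrite reJ.
by under eq_fun do rewrite imJ; rewrite imJ; exact: is_derive_opp.
Qed.

Lemma mcont_adj m n (A : R -> 'M[C]_(m, n)) D :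
  mcont D A -> mcont D (fun s => adjmx (A s)).
Proof.
move=> Ad i j; under eq_fun do rewrite !mxE.
have [A1 A2] := Ad j i; split; first by under eq_fun do rewrite reJ.
by under eq_fun do rewrite imJ; move=> x; apply: cvgN; exact: A2.
Qed.

(** Pairing with the fixed vector [z = f b - f a] makes the problem scalar: by Cauchy-Schwarz,
    [h = <z, f> - |z| g] has derivative at most [|z| (|f'| - g') <= 0]. Hence [h b <= h a], that is,
    [|z|^2 <= |z| (g b - g a)]. *)
Lemma vmean_value n (f f' : R -> 'cV[C]_n) (g g' : R -> R) a b : a <= b ->
  mcont `[a, b] f -> {within `[a, b], continuous g} ->
  (forall t, t \in `]a, b[%R -> mder f t (f' t)) ->
  (forall t, t \in `]a, b[%R -> is_derive t 1 g (g' t)) ->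
  (forall t, t \in `]a, b[%R -> vnorm (f' t) <= g' t) ->
  vnorm (f b - f a) <= g b - g a.
Proof.
rewrite le_eqVlt => /predU1P[<-|ab] cf cg df dg fg; first by rewrite !subrr vnorm0.
(* This is the claim itself when [z = 0], where [|z|] cannot be divided out. *)
have g_ab : 0 <= g b - g a.
  have [c cab ->] := MVT ab dg cg.
  by rewrite mulr_ge0 ?subr_ge0 ?(ltW ab) // (le_trans (vnorm_ge0 _) (fg _ cab)).
set z := f b - f a.
have [->//|z0] := eqVneq (vnorm z) 0.
have z_gt0 : 0 < vnorm z by rewrite lt0r z0 vnorm_ge0.
pose h t := redot z (f t) + - (vnorm z * g t).
have dh t : t \in `]a, b[%R -> is_derive t 1 h (redot z (f' t) + - (vnorm z * g' t)).
  move=> tab; apply: is_derive_add; last first.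
    apply: is_derive_opp; apply: (is_derive_conv (is_derive_mul (is_derive_cst _ _ _) (dg _ tab))).
    by rewrite mulr0 addr0.
  apply: is_derive_big => i; have [d1 d2] := df _ tab i 0.
  apply: (is_derive_conv (is_derive_add (is_derive_mul (is_derive_cst _ _ _) d1)
    (is_derive_mul (is_derive_cst _ _ _) d2))).
  by rewrite !mulr0 !addr0.
have ch : {within `[a, b], continuous h}.
  move=> x; apply: cvgB; last by apply: cvgM; [exact: cvg_cst|exact: cg].
  move: x; apply: within_big => i x; have [c1 c2] := cf i 0.
  by apply: cvgD; apply: cvgM; [exact: cvg_cst|exact: c1|exact: cvg_cst|exact: c2].
have [c cab hab] := MVT ab dh ch.
have : h b - h a <= 0.
  rewrite hab mulr_le0_ge0 ?subr_ge0 ?(ltW ab) // subr_le0.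
  by rewrite (le_trans (redot_le _ _)) // ler_wpM2l ?vnorm_ge0 // fg.
rewrite /h opprD opprK addrACA -redotBr -/z -sqr_vnorm expr2.
rewrite [- _ + _]addrC -mulrBr -opprB mulrN -mulrBr pmulr_rle0 //.
by rewrite subr_le0.
Qed.

Lemma nrm_scalar_vnorm (z : C) : vnorm (z%:M : 'cV[C]_1) = nrm z.
Proof. by rewrite nrmE /vnorm big_ord1 !mxE eqxx mulr1n. Qed.

Lemma cmean_value (f f' : R -> C) (g g' : R -> R) (a b : R) : a <= b ->
  (forall t, cder f t (f' t)) -> (forall t : R, is_derive t 1 g (g' t)) ->
  (forall t, t \in `]a, b[%R -> nrm (f' t) <= g' t) ->
  nrm (f b - f a) <= g b - g a.
Proof.
move=> ab df dg fg.
have mdf t : mder (fun t => (f t)%:M : 'cV[C]_1) t (f' t)%:M.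
  by move=> i j; under eq_fun do rewrite mxE !ord1 mulr1n; rewrite mxE !ord1 mulr1n.
rewrite -nrm_scalar_vnorm raddfB.
apply: (@vmean_value 1 (fun t => (f t)%:M) (fun t => (f' t)%:M) g g' a b ab) => //.
- by move=> i j; apply: cder_ccont => t; exact: mdf.
- apply: continuous_subspaceT => t; apply: differentiable_continuous.
  by apply/derivable1_diffP; case: (dg t).
- by move=> t tab; rewrite nrm_scalar_vnorm fg.
Qed.

Lemma cder_expi a b t : cder (fun s => expi (a * s + b)) t (iC * rc a * expi (a * t + b)).
Proof.
have da : is_derive t 1 (fun s => a * s + b) a.
  apply: (is_derive_conv (is_derive_add (is_derive_mul (is_derive_cst a t 1) (is_derive_id t 1))
    (is_derive_cst b t 1))).
  by rewrite mulr0 !addr0 mulr1.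
split.
  apply: (is_derive_conv (@is_derive1_comp R cos (fun s => a * s + b) t _ _ (is_derive_cos _) da)).
  by rewrite /=; ring.
apply: (is_derive_conv (@is_derive1_comp R sin (fun s => a * s + b) t _ _ (is_derive_sin _) da)).
by rewrite /=; ring.
Qed.

Lemma cderD f g t (df dg : C) : cder f t df -> cder g t dg ->
  cder (fun s => f s + g s) t (df + dg).
Proof.
move=> [f1 f2] [g1 g2]; split.
  by under eq_fun do rewrite reD; rewrite reD; exact: is_derive_add.
by under eq_fun do rewrite imD; rewrite imD; exact: is_derive_add.
Qed.

Lemma cder_big k (f : 'I_k -> R -> C) t (df : 'I_k -> C) :
  (forall i, cder (f i) t (df i)) ->
  cder (fun s => \sum_(i < k) f i s) t (\sum_(i < k) df i).
Proof.
move=> fd; split.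
  under eq_fun do rewrite re_sum; rewrite re_sum.
  by apply: is_derive_big => i; case: (fd i).
under eq_fun do rewrite im_sum; rewrite im_sum.
by apply: is_derive_big => i; case: (fd i).
Qed.

Lemma cder_rc (f : R -> R) (t df : R) : is_derive t 1 f df -> cder (fun s => rc (f s)) t (rc df).
Proof. by move=> fd; split => //=; exact: is_derive_cst. Qed.

(** The normalized powers form a chain under differentiation, as do the remainders [expi_rem k] up
    to a factor i; this makes the two comparable by induction on [k]. *)
Lemma is_derive_pow_fact k (t : R) :
  is_derive t 1 (fun s : R => s ^+ k.+1 / (k.+1)`!%:R) (t ^+ k / k`!%:R).
Proof.
elim: k => [|k IH].
  under eq_fun do rewrite /= invr1 expr1 mulr1.
  by rewrite invr1 expr0 mulr1; exact: is_derive_id.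
have k1 : ((k.+2)%:R : R) != 0 by rewrite pnatr_eq0.
have f1 : ((k.+1)`!%:R : R) != 0 by rewrite pnatr_eq0 -lt0n fact_gt0.
have f0 : (k`!%:R : R) != 0 by rewrite pnatr_eq0 -lt0n fact_gt0.
(* Peeling off [s / (k+2)] exposes the induction hypothesis to the product rule. *)
have -> : (fun s : R => s ^+ k.+2 / (k.+2)`!%:R) =
    (fun s => (k.+2%:R)^-1 * (s * (s ^+ k.+1 / (k.+1)`!%:R))).
  apply/funext => s; rewrite factS natrM exprS.
  move: (k.+2%:R : R) k1 ((k.+1)`!%:R : R) f1 => a a0 b b0.
  by field; rewrite a0 b0.
apply: (is_derive_conv (is_derive_mul (is_derive_cst (k.+2%:R^-1 : R) t 1)
  (is_derive_mul (is_derive_id _ _) IH))).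
rewrite mulr0 addr0 exprS factS natrM.
have k2 : (k.+1%:R : R) != 0 by rewrite pnatr_eq0.
rewrite -[k.+2]add1n natrD in k1 *.
move: (k.+1%:R : R) k1 k2 (k`!%:R : R) f0 => a a1 a0 b b0.
by rewrite /cst; field; rewrite b0 a0 a1.
Qed.

Definition expi_rem k (x : R) : C := expi x - \sum_(j < k) (j`!%:R : C)^-1 * (iC * rc x) ^+ j.

Lemma exp_term j (x : R) : (j`!%:R : C)^-1 * (iC * rc x) ^+ j = iC ^+ j * rc (x ^+ j / j`!%:R).
Proof.
by rewrite exprMn -rmorphXn /= mulrCA rmorphM fmorphV rmorph_nat [_^-1 * _]mulrC.
Qed.

(** Differentiation kills the constant Taylor term and sends every other term to i times its
    predecessor, so the order drops by one. *)
Lemma cder_expi_rem k t : cder (expi_rem k.+1) t (iC * expi_rem k t).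
Proof.
have e1 : cder (@expi R) t (iC * expi t).
  have := cder_expi 1 0 t; rewrite rmorph1 mulr1 mul1r addr0.
  by under eq_fun do rewrite mul1r addr0.
rewrite mulrBr; apply: cderD => //.
(* The term [j = 0] is split off as the constant -1, and the sign becomes a factor -1, so that
   [cderD], [cderM] and [cder_big] apply. *)
have -> : (fun s => - (\sum_(j < k.+1) (j`!%:R : C)^-1 * (iC * rc s) ^+ j)) =
    (fun s => -1 + (-1) * \sum_(j < k) iC ^+ j.+1 * rc (s ^+ j.+1 / (j.+1)`!%:R)).
  apply/funext => s; rewrite big_ord_recl /= invr1 expr0 mulr1 opprD mulN1r.
  by congr (- 1 - _); apply: eq_bigr => i _; rewrite -exp_term.
have -> : - (iC * \sum_(j < k) (j`!%:R : C)^-1 * (iC * rc t) ^+ j) =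
   0 + (0 * (\sum_(j < k) iC ^+ j.+1 * rc (t ^+ j.+1 / (j.+1)`!%:R))
     + (-1) * \sum_(j < k) iC ^+ j.+1 * rc (t ^+ j / j`!%:R)).
  rewrite mul0r !add0r mulN1r big_distrr; congr (- _); apply: eq_bigr => i _ /=.
  by rewrite exp_term exprS mulrA.
apply: cderD; first exact: cder_cst.
apply: cderM; first exact: cder_cst.
apply: cder_big => i.
have := cderM (cder_cst (iC ^+ i.+1) t) (cder_rc (is_derive_pow_fact i t)).
by rewrite mul0r add0r.
Qed.

Lemma nrm_expi x : nrm (expi x) = 1.
Proof. by rewrite nrmE /= cos2Dsin2 sqrtr1. Qed.

Lemma expi0 : expi 0 = 1 :> C.
Proof. by apply: complex_eqP; rewrite /= ?cos0 ?sin0. Qed.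

(** Induction on [k]: the remainder of order k+1 vanishes at 0, and its derivative has modulus at
    most t^k/k!, the derivative of t^(k+1)/(k+1)!. Order 0 is |exp(ix)| = 1. *)
Lemma expi_rem_le_pos k x : 0 <= x -> nrm (expi_rem k x) <= x ^+ k / k`!%:R.
Proof.
elim: k x => [|k IH] x x0.
  by rewrite /expi_rem big_ord0 subr0 nrm_expi expr0 invr1 mulr1.
have r0 : expi_rem k.+1 0 = 0.
  rewrite /expi_rem expi0 big_ord_recl /= expr0 invr1 mulr1 big1 ?addr0 ?subrr //.
  by move=> i _; rewrite rmorph0 mulr0 expr0n /= mulr0.
rewrite -[expi_rem _ x]subr0 -r0.
rewrite -[X in _ <= X]subr0 [X in _ <= _ - X](_ : _ = 0 ^+ k.+1 / (k.+1)`!%:R); last first.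
  by rewrite expr0n /= mul0r.
apply: (cmean_value (g := fun x => x ^+ k.+1 / (k.+1)`!%:R) x0).
- by move=> t; exact: cder_expi_rem.
- by move=> t; exact: is_derive_pow_fact.
- move=> t; rewrite in_itv /= => /andP[t0 _].
  by rewrite Normc.normcM nrm_iC mul1r IH // ltW.
Qed.

Lemma expi_rem_le k x : nrm (expi_rem k x) <= `|x| ^+ k / k`!%:R.
Proof.
have [x0|x0] := leP 0 x; first by rewrite (ger0_norm x0) expi_rem_le_pos.
(* The remainder at -x is the complex conjugate of the remainder at x. *)
have -> : nrm (expi_rem k x) = nrm (expi_rem k (- x)).
  have -> : expi_rem k (- x) = conjc (expi_rem k x); last first.
    by rewrite !nrmE reJ imJ sqrrN.
  rewrite /expi_rem rmorphB /= rmorph_sum /=; congr (_ - _).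
    by apply: complex_eqP; rewrite /= ?cosN ?sinN.
  apply: eq_bigr => j _; rewrite rmorphM rmorphXn rmorphM fmorphV rmorph_nat.
  congr (_ * _ ^+ _); by apply: complex_eqP => /=; ring.
by rewrite (ltr0_norm x0) expi_rem_le_pos // oppr_ge0 ltW.
Qed.

End ComplexCalculus.

(** * Exponentials of skew-Hermitian matrices *)

Section SkewExponential.
Variable R : realType.
Local Notation C := (Cc R).
Local Notation re z := (complex.Re ((z : C) : R[i])).
Local Notation im z := (complex.Im ((z : C) : R[i])).
Local Notation nrm z := (Normc.normc ((z : C) : R[i])).

(** [M] is approximated by the partial sums of [m] as well as an exponential with exponent of size
    [c] would be, at every order. The bounds on the single terms are included because products need
    them. *)
Definition taylor n (M : 'M[C]_n) (m : nat -> 'M[C]_n) (c : R) :=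
  [/\ 0 <= c, forall k, opbound (M - \sum_(j < k) m j) (c ^+ k / k`!%:R)
    & forall j, opbound (m j) (c ^+ j / j`!%:R)].

Definition expm_coef n (A : 'M[C]_n) k := (k`!%:R : C)^-1 *: A ^+ k.

Definition cauchy_prod n (m m' : nat -> 'M[C]_n) k := \sum_(i < k.+1) m i *m m' (k - i)%N.

Lemma exp_fact_binomial (a b : R) k :
  \sum_(i < k.+1) (a ^+ i / i`!%:R) * (b ^+ (k - i) / (k - i)`!%:R) = (a + b) ^+ k / k`!%:R.
Proof.
rewrite addrC exprDn big_distrl; apply: eq_bigr => i _ /=.
have ik : (i <= k)%N by rewrite -ltnS.
have := congr1 (fun n => n%:R : R) (bin_fact ik); rewrite !natrM /= -mulr_natr => <-.
have f1 : (i`!%:R : R) != 0 by rewrite pnatr_eq0 -lt0n fact_gt0.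
have f2 : ((k - i)`!%:R : R) != 0 by rewrite pnatr_eq0 -lt0n fact_gt0.
have f3 : ('C(k, i)%:R : R) != 0 by rewrite pnatr_eq0 -lt0n bin_gt0.
by field; rewrite f1 f2 f3.
Qed.

(** The triangle of index pairs with i + j < k, regrouped by the index of the left factor. *)
Lemma cauchy_prod_sum n (m m' : nat -> 'M[C]_n) k :
  \sum_(j < k) cauchy_prod m m' j = \sum_(i < k) m i *m (\sum_(j < k - i) m' j).
Proof.
elim: k => [|k IH]; first by rewrite !big_ord0.
rewrite big_ord_recr /= IH [RHS]big_ord_recr /= subSnn big_ord1.
rewrite /cauchy_prod big_ord_recr /= subnn addrA; congr (_ + _).
rewrite -big_split; apply: eq_bigr => i _ /=.
by rewrite -mulmxDr subSn ?big_ord_recr // ltnW.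
Qed.

(** Each left term [m i] is paired with the remainder of order k - i of [M'], and the remainder of
    order k of [M] with [M'] itself. The resulting bounds are exactly the terms of the binomial
    expansion of (a + b)^k / k!. *)
Lemma taylorM n (M M' : 'M[C]_n) m m' a b :
  taylor M m a -> taylor M' m' b -> taylor (M *m M') (cauchy_prod m m') (a + b).
Proof.
move=> [a0 Mm ma] [b0 Mm' mb].
have tg0 (x : R) k : 0 <= x -> 0 <= x ^+ k / k`!%:R by move=> x0; rewrite divr_ge0 // exprn_ge0.
split=> [|k|k]; first exact: addr_ge0.
  (* The last factor is [M'] minus an empty sum, so that it appears as the summand i = k. *)
  have -> : M *m M' - \sum_(j < k) cauchy_prod m m' j =
      \sum_(i < k) m i *m (M' - \sum_(j < k - i) m' j)
      + (M - \sum_(i < k) m i) *m (M' - \sum_(j < k - k) m' j).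
    rewrite cauchy_prod_sum subnn big_ord0 subr0.
    under [in RHS]eq_bigr do rewrite mulmxBr.
    by rewrite sumrB -mulmx_suml mulmxBl [RHS]addrC addrA subrK.
  rewrite -exp_fact_binomial big_ord_recr /=; apply: opboundD.
    by apply: opbound_sum => i; apply: opboundM; [exact: tg0|exact: ma|exact: Mm'].
  by apply: opboundM; [exact: tg0|exact: Mm|exact: Mm'].
rewrite -exp_fact_binomial; apply: opbound_sum => i.
by apply: opboundM; [exact: tg0|exact: ma|exact: mb].
Qed.

Definition skew_form n (A P : 'M[C]_n) (th : 'I_n -> R) :=
  P *m adjmx P = 1%:M /\ A = adjmx P *m diag_mx (\row_k (iC * rc (th k))) *m P.

(** The exponential of a matrix in [skew_form], written through its eigenvalues [i th k]. In this
    form, unitarity and differentiation in time reduce to facts about [expi]. *)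
Definition unitary_exp n (P : 'M[C]_n) (th : 'I_n -> R) : 'M[C]_n :=
  adjmx P *m diag_mx (\row_k expi (th k)) *m P.

(** A skew-Hermitian matrix commutes with its adjoint, so the spectral theorem for normal matrices
    applies; its eigenvalues are then shown to be imaginary. *)
Lemma skew_formP n (A : 'M[C]_n) : adjmx A = - A -> exists P th, skew_form A P th.
Proof.
move=> Askew.
have adjE m (B : 'M[C]_m) : adjmx B = map_mx Num.conj B^T.
  by apply/matrixP => i j; rewrite !mxE.
have An : A \is spectral.normalmx.
  by apply/spectral.normalmxP; rewrite -!adjE Askew mulmxN mulNmx.
have := elimT (@spectral.orthomx_spectralP _ _ A) An; rewrite /=.
have := spectral.spectral_unitarymx A.
set P := spectral.spectralmx A; set d := spectral.spectral_diag A => Pu.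
rewrite (spectral.invmx_unitary Pu) -adjE => AE.
have PP : P *m adjmx P = 1%:M by rewrite adjE; exact: (elimT spectral.unitarymxP Pu).
(* Undoing the unitary conjugation in [adjmx A = - A] gives the same identity for the diagonal of
   eigenvalues, whose real parts therefore vanish. *)
have dE : diag_mx (map_mx (fun z : C => (conjc z : C)) d) = - diag_mx d.
  have inv X : P *m (adjmx P *m X *m P) *m adjmx P = X.
    by rewrite !mulmxA PP mul1mx -mulmxA PP mulmx1.
  have AE' : adjmx A = adjmx P *m diag_mx (map_mx (fun z : C => (conjc z : C)) d) *m P.
    by rewrite {1}AE !adjmxM adjmx_diag adjmxK mulmxA.
  by rewrite -[LHS]inv -AE' Askew {1}AE mulmxN mulNmx inv.
exists P, (fun k => im (d 0 k)); split=> //.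
rewrite {1}AE; congr (_ *m diag_mx _ *m _).
apply/matrixP => i k; rewrite ord1 !mxE.
have := congr1 (fun B : 'M[C]_n => B k k) dE; rewrite !mxE eqxx !mulr1n.
move=> /(congr1 (fun z : C => re z)); rewrite reJ reN => rN.
apply: complex_eqP; rewrite ?reM ?imM /=; first by lra.
by rewrite mul0r mul1r add0r.
Qed.

Lemma conj_diagM n (P : 'M[C]_n) (d e : 'rV[C]_n) : P *m adjmx P = 1%:M ->
  (adjmx P *m diag_mx d *m P) *m (adjmx P *m diag_mx e *m P) =
  adjmx P *m diag_mx (\row_k (d 0 k * e 0 k)) *m P.
Proof.
move=> PP; rewrite !mulmxA -[_ *m P *m adjmx P]mulmxA PP mulmx1 -[_ *m _ *m diag_mx e]mulmxA.
by rewrite mulmx_diag.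
Qed.

Lemma skew_form_exp n (A P : 'M[C]_n) th k : skew_form A P th ->
  A ^+ k = adjmx P *m diag_mx (\row_j ((iC * rc (th j)) ^+ k)) *m P.
Proof.
move=> [PP AE]; have PP' := mulmx1C PP; elim: k => [|k IH].
  rewrite expr0 (_ : \row_j _ = const_mx 1); last by apply/matrixP => i j; rewrite !mxE expr0.
  by rewrite diag_const_mx mulmx1 PP'.
rewrite exprS IH {1}AE [LHS](conj_diagM _ _ PP); congr (_ *m diag_mx _ *m _).
by apply/matrixP => i j; rewrite !mxE exprS.
Qed.

(** The bound on [A] is tested on the k-th eigenvector, a column of [adjmx P]. *)
Lemma skew_form_le n (A P : 'M[C]_n) th c k : skew_form A P th -> opbound A c -> `|th k| <= c.
Proof.
move=> [PP AE] /(_ (adjmx P *m delta_mx k 0)).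
have PP' := mulmx1C PP.
rewrite AE -!mulmxA [P *m (adjmx P *m _)]mulmxA PP mul1mx.
rewrite ![vnorm (adjmx P *m _)]vnorm_isometry ?adjmxK // vnorm_delta mulr1.
rewrite (_ : diag_mx _ *m _ = (iC * rc (th k)) *: delta_mx k 0); last first.
  apply/matrixP => i j; rewrite mul_diag_mx !mxE.
  by case: (eqVneq i k) => [->//|_]; rewrite /= !mulr0.
by rewrite vnormZ vnorm_delta mulr1 Normc.normcM nrm_iC nrm_rc mul1r.
Qed.

Lemma opbound_conj_diag n (P : 'M[C]_n) (d : 'rV[C]_n) c : 0 <= c ->
  P *m adjmx P = 1%:M -> (forall i, nrm (d 0 i) <= c) ->
  opbound (adjmx P *m diag_mx d *m P) c.
Proof.
move=> c0 PP dc; have PP' := mulmx1C PP.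
rewrite -[c]mulr1 -[c]mul1r; apply: opboundM; first by rewrite mul1r.
  apply: opboundM => //; last exact: opbound_diag.
  by apply: opbound_isometry; rewrite adjmxK.
exact: opbound_isometry.
Qed.

Lemma conj_diag_sum n (P : 'M[C]_n) (I : Type) (s : seq I) (F : I -> 'rV[C]_n) :
  \sum_(i <- s) adjmx P *m diag_mx (F i) *m P =
  adjmx P *m diag_mx (\sum_(i <- s) F i) *m P.
Proof. by rewrite raddf_sum mulmx_sumr mulmx_suml. Qed.

(** Up to conjugation by [P], the remainder is diagonal with entries [expi_rem k (th i)], and
    [skew_form_le] bounds every [th i] by [c]. *)
Lemma unitary_exp_taylor n (A P : 'M[C]_n) th c : 0 <= c -> skew_form A P th -> opbound A c ->
  taylor (unitary_exp P th) (expm_coef A) c.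
Proof.
move=> c0 Af Ac; have [PP AE] := Af.
have thc k := skew_form_le k Af Ac.
have termE k : expm_coef A k =
    adjmx P *m diag_mx (\row_j ((k`!%:R : C)^-1 * (iC * rc (th j)) ^+ k)) *m P.
  rewrite /expm_coef (skew_form_exp k Af) scalemxAl scalemxAr; congr (_ *m _ *m _).
  apply/matrixP => i j; rewrite !mxE; case: eqP => _; first by rewrite !mulr1n.
  by rewrite !mulr0n mulr0.
have tg0 k : 0 <= c ^+ k / k`!%:R by rewrite divr_ge0 // exprn_ge0.
have tle k x : `|x| <= c -> `|x| ^+ k / k`!%:R <= c ^+ k / k`!%:R.
  by move=> xc; rewrite ler_wpM2r ?invr_ge0 // lerXn2r ?nnegrE.
split=> // k.
  under eq_bigr do rewrite termE.
  rewrite conj_diag_sum -mulmxBl -mulmxBr -raddfB /=.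
  apply: opbound_conj_diag => // i.
  rewrite !mxE summxE; under eq_bigr do rewrite mxE.
  by rewrite (le_trans (expi_rem_le k (th i))) // tle.
rewrite termE; apply: opbound_conj_diag => // i; rewrite mxE exp_term.
rewrite Normc.normcM nrm_rc.
have -> : nrm (iC ^+ k) = 1.
  by elim: k => [|k IH]; rewrite ?expr0 ?Normc.normc1 // exprS Normc.normcM IH nrm_iC mulr1.
by rewrite mul1r normrM normrX [X in _ * X]ger0_norm ?invr_ge0 // tle.
Qed.

Lemma taylor_cvg n (M : 'M[C]_n) m c : taylor M m c -> series m @ \oo --> M.
Proof.
move=> [c0 Mm _]; apply/cvg_ballP => e e0.
(* The radius [e] is a complex number; its positivity forces the imaginary part to vanish, so it
   comes from a real radius. *)
have er : 0 < re e by move: e0; rewrite ltcE => /andP[].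
have eE : e = rc (re e).
  by move: e0; rewrite ltcE => /andP[/eqP im0 _]; apply: complex_eqP.
have := cvg_series_cvg_0 (is_cvg_series_exp_coeff c).
move=> /cvgrPdist_lt /(_ _ er); apply: filterS => k.
rewrite /exp_coeff sub0r normrN ger0_norm ?divr_ge0 ?exprn_ge0 // => ck; split=> // i j.
rewrite /series /= -ball_normE /= eE normc_def /rc ltcR.
rewrite -nrmE (_ : M i j - _ = (M - \sum_(j < k) m j) i j); last by rewrite !mxE big_mkord.
exact: le_lt_trans (opbound_entry i j (Mm k)) ck.
Qed.

(** The exponential series converges to [unitary_exp] by the remainder bounds of the latter, so the
    two matrices agree. *)
Lemma mexp_taylor n (A : 'M[C]_n) c : 0 <= c -> adjmx A = - A -> opbound A c ->
  taylor (mexp A) (expm_coef A) c.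
Proof.
move=> c0 /skew_formP [P [th Af]] Ac.
have Et := unitary_exp_taylor c0 Af Ac.
suff -> : mexp A = unitary_exp P th by [].
apply: cvg_lim; first exact: norm_hausdorff.
exact: taylor_cvg Et.
Qed.

End SkewExponential.

(** * The symmetric product of group commutators *)

Section GroupCommutator.
Variable R : realType.
Local Notation C := (Cc R).

Lemma cauchy_prod0 n (m m' : nat -> 'M[C]_n) : cauchy_prod m m' 0 = m 0%N *m m' 0%N.
Proof. by rewrite /cauchy_prod big_ord1. Qed.

Lemma cauchy_prod1 n (m m' : nat -> 'M[C]_n) :
  cauchy_prod m m' 1 = m 0%N *m m' 1%N + m 1%N *m m' 0%N.
Proof. by rewrite /cauchy_prod !big_ord_recl big_ord0 addr0. Qed.

Lemma cauchy_prod2 n (m m' : nat -> 'M[C]_n) :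
  cauchy_prod m m' 2 = m 0%N *m m' 2%N + (m 1%N *m m' 1%N + m 2%N *m m' 0%N).
Proof. by rewrite /cauchy_prod !big_ord_recl big_ord0 addr0. Qed.

Lemma cauchy_prod3 n (m m' : nat -> 'M[C]_n) :
  cauchy_prod m m' 3 =
  m 0%N *m m' 3%N + (m 1%N *m m' 2%N + (m 2%N *m m' 1%N + m 3%N *m m' 0%N)).
Proof. by rewrite /cauchy_prod !big_ord_recl big_ord0 addr0. Qed.

(** Here [q] and [q'] are the coefficients of Q(s) and Q(-s). Both Q(s)Q(-s) and Q(-s)Q(s) have no
    linear term and the same quadratic term 2 q2 - q1^2; their cubic terms are opposite commutators
    of q1 and q2, which cancel in the product. *)
Lemma palindrome_taylor n (q q' : nat -> 'M[C]_n) :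
  q 0%N = 1%:M -> (forall k, q' k = (-1) ^+ k *: q k) ->
  \sum_(j < 4) cauchy_prod (cauchy_prod q q') (cauchy_prod q' q) j =
  1%:M + (q 2%N + q 2%N - q 1%N *m q 1%N) *+ 2.
Proof.
move=> q0 qE.
have q'0 : q' 0%N = 1%:M by rewrite qE scale1r.
have q'1 : q' 1%N = - q 1%N by rewrite qE expr1 scaleN1r.
have q'2 : q' 2%N = q 2%N by rewrite qE sqrrN expr1n scale1r.
have q'3 : q' 3%N = - q 3%N by rewrite qE exprS sqrrN expr1n mulr1 scaleN1r.
have z0 : cauchy_prod q q' 0 = 1%:M by rewrite cauchy_prod0 q0 q'0 mul1mx.
have z'0 : cauchy_prod q' q 0 = 1%:M by rewrite cauchy_prod0 q0 q'0 mul1mx.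
have z1 : cauchy_prod q q' 1 = 0.
  by rewrite cauchy_prod1 q0 q'0 q'1 mul1mx mulmx1 addNr.
have z'1 : cauchy_prod q' q 1 = 0.
  by rewrite cauchy_prod1 q0 q'0 q'1 mul1mx mulmx1 subrr.
have z2 : cauchy_prod q q' 2 = q 2%N + q 2%N - q 1%N *m q 1%N.
  by rewrite cauchy_prod2 q0 q'0 q'1 q'2 mul1mx mulmx1 mulmxN addrCA addrC.
have z'2 : cauchy_prod q' q 2 = q 2%N + q 2%N - q 1%N *m q 1%N.
  by rewrite cauchy_prod2 q0 q'0 q'1 q'2 mul1mx mulmx1 mulNmx addrCA addrC.
have z3 : cauchy_prod q' q 3 + cauchy_prod q q' 3 = 0.
  rewrite !cauchy_prod3 q0 q'0 q'1 q'2 q'3 !mul1mx !mulmx1 !mulNmx !mulmxN.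
  move: (q 3%N) (q 1%N *m q 2%N) (q 2%N *m q 1%N) => x y z.
  by apply/matrixP => i j; rewrite !mxE; ring.
rewrite !big_ord_recl big_ord0 addr0 /= cauchy_prod0 cauchy_prod1 cauchy_prod2 cauchy_prod3.
rewrite z0 z'0 z1 z'1 z2 z'2 !mul1mx !mulmx1 !mul0mx !mulmx0 !add0r.
by rewrite z3 addr0 -mulr2n.
Qed.

Lemma expm_coefN n (A : 'M[C]_n) k : expm_coef (- A) k = (-1) ^+ k *: expm_coef A k.
Proof.
rewrite /expm_coef scalerA mulrC -scalerA; congr (_ *: _).
elim: k => [|k IH]; first by rewrite !expr0 scale1r.
by rewrite !exprS IH -!mulmxE mulNmx mulN1r scaleNr -scalemxAr.
Qed.

Lemma expm_coef0 n (A : 'M[C]_n) : expm_coef A 0 = 1%:M.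
Proof. by rewrite /expm_coef expr0 invr1 scale1r. Qed.

Lemma expm_coef1 n (A : 'M[C]_n) : expm_coef A 1 = A.
Proof. by rewrite /expm_coef expr1 invr1 scale1r. Qed.

Lemma expm_coef2 n (A : 'M[C]_n) : expm_coef A 2 + expm_coef A 2 = A *m A.
Proof.
rewrite /expm_coef -scalerDl [X in X *: _](_ : _ = 1) ?scale1r ?expr2 //.
have n2 : (2 : C) != 0 by rewrite pnatr_eq0.
by rewrite -[2`!]/2%N; field.
Qed.

(** Eight factors, four of radius [a] and four of radius [b], give the total radius 4(a + b); the
    remainder is taken at order 4, whence 24 = 4!. *)
Lemma commutator_taylor n (A B eA eA' eB eB' : 'M[C]_n) a b :
  taylor eA (expm_coef A) a -> taylor eA' (expm_coef (- A)) a ->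
  taylor eB (expm_coef B) b -> taylor eB' (expm_coef (- B)) b ->
  opbound (eB *m eA *m eB' *m eA' *m eB' *m eA' *m eB *m eA
     - (1%:M + (B *m A - A *m B) *+ 2)) ((4 * (a + b)) ^+ 4 / 24).
Proof.
move=> TA TA' TB TB'.
pose q := cauchy_prod (expm_coef B) (expm_coef A).
pose q' := cauchy_prod (expm_coef (- B)) (expm_coef (- A)).
have TQ : taylor (eB *m eA) q (b + a) := taylorM TB TA.
have TQ' : taylor (eB' *m eA') q' (b + a) := taylorM TB' TA'.
have [_ /(_ 4%N) TW _] := taylorM (taylorM TQ TQ') (taylorM TQ' TQ).
have q0 : q 0%N = 1%:M by rewrite /q cauchy_prod0 !expm_coef0 mul1mx.
have q'E k : q' k = (-1) ^+ k *: q k.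
  rewrite /q' /q /cauchy_prod scaler_sumr; apply: eq_bigr => i _.
  rewrite !expm_coefN -scalemxAl -scalemxAr scalerA -exprD subnKC //.
  by rewrite -ltnS.
rewrite (palindrome_taylor q0 q'E) in TW.
(* With q1 = B + A and 2 q2 = B^2 + 2BA + A^2, subtracting (B + A)^2 leaves the commutator. *)
have q2 : q 2%N + q 2%N - q 1%N *m q 1%N = B *m A - A *m B.
  rewrite /q cauchy_prod1 cauchy_prod2 !expm_coef0 !expm_coef1 !mul1mx !mulmx1.
  rewrite addrACA expm_coef2 addrACA expm_coef2.
  rewrite mulmxDl !mulmxDr; move: (A *m A) (A *m B) (B *m A) (B *m B) => x y z w.
  by apply/matrixP => i j; rewrite !mxE; ring.
rewrite q2 in TW.
rewrite !mulmxA in TW; apply: opbound_le TW.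
have -> : b + a + (b + a) + (b + a + (b + a)) = 4 * (a + b) by ring.
by rewrite -[4`!]/24%N.
Qed.

(** Both matrices are compared with 1 + X, where X = 2(BA - AB): [E] through its remainder of order
    2, the product through its remainder of order 4. *)
Lemma commutator_exp_bound n (A B E eA eA' eB eB' : 'M[C]_n) a b :
  taylor eA (expm_coef A) a -> taylor eA' (expm_coef (- A)) a ->
  taylor eB (expm_coef B) b -> taylor eB' (expm_coef (- B)) b ->
  taylor E (expm_coef ((B *m A - A *m B) *+ 2)) (4 * (a * b)) ->
  opbound (E - eB *m eA *m eB' *m eA' *m eB' *m eA' *m eB *m eA) (12 * (a + b) ^+ 4).
Proof.
move=> TA TA' TB TB' [_ /(_ 2%N) TE _].
have [[a0 _ _] [b0 _ _]] := (TA, TB).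
move: TE; rewrite !big_ord_recl big_ord0 addr0 expm_coef0 expm_coef1 => TE.
have TW := commutator_taylor TA TA' TB TB'.
have := opboundB TE TW; rewrite opprB addrA subrK; apply: opbound_le.
(* From 4ab <= (a + b)^2, which is (a - b)^2 >= 0. *)
have ab : (4 * (a * b)) ^+ 2 <= (a + b) ^+ 4.
  rewrite [X in _ <= X](_ : _ = ((a + b) ^+ 2) ^+ 2); last by rewrite -exprM.
  rewrite lerXn2r ?nnegrE ?mulr_ge0 ?sqr_ge0 ?addr_ge0 //.
  by have := sqr_ge0 (a - b); nra.
have c4 : 0 <= (a + b) ^+ 4 by rewrite exprn_ge0 // addr_ge0.
(* The total constant is 256/24 + 1/2 = 67/6, rounded up to 12. *)
by rewrite -[2`!]/2%N [(4 * (a + b)) ^+ 4]exprMn; move: ((a + b) ^+ 4) ab c4 => x; rewrite /=; lra.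
Qed.

End GroupCommutator.

(** * Skew-Hermitian evolutions *)

Section SkewEvolution.
Variable R : realType.
Local Notation C := (Cc R).
Local Notation re z := (complex.Re ((z : C) : R[i])).
Local Notation im z := (complex.Im ((z : C) : R[i])).
Local Notation nrm z := (Normc.normc ((z : C) : R[i])).

(** Balls of complex matrices control the modulus of each entry, which dominates both parts. The
    filter is arbitrary because the lemma serves both continuity within a subset and limits of
    difference quotients. *)
Lemma mx_cvg_reim (T : Type) (F : set_system T) (FF : Filter F) m n
    (f : T -> 'M[C]_(m, n)) (M : 'M[C]_(m, n)) i j :
  f @ F --> M -> ((fun t => re (f t i j)) @ F --> re (M i j)) /\
    ((fun t => im (f t i j)) @ F --> im (M i j)).
Proof.
move=> fM.
have close e : 0 < e -> \forall t \near F, nrm (M i j - f t i j) < e.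
  move=> e0; have ec : 0 < rc e :> C by rewrite /rc ltcR.
  move/cvg_ballP: fM => /(_ _ ec); apply: filterS => t [_ /(_ i j)].
  by rewrite -ball_normE /= normc_def /rc ltcR -nrmE.
split; apply/cvgrPdist_lt => e /close; apply: filterS => t; apply: le_lt_trans;
  rewrite -?reN -?imN -?reD -?imD nrmE -sqrtr_sqr ler_sqrt ?addr_ge0 ?sqr_ge0 //.
  by rewrite lerDl sqr_ge0.
by rewrite lerDr sqr_ge0.
Qed.

Lemma continuous_mcont m n (D : set R) (U : R -> 'M[C]_(m, n)) :
  {within D, continuous U} -> mcont D U.
Proof.
by move=> cU i j; split => x; have [] := mx_cvg_reim _ i j (cU x).
Qed.

Lemma cvg_is_derive (f : R -> R) (t d : R) :
  (fun h => h^-1 * (f (t + h) - f t)) @ 0^' --> d -> is_derive t 1 f d.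
Proof.
move=> fd.
have E : (fun h : R => h^-1 *: ((f \o shift t) (h *: (1 : R)) - f t)) =
    (fun h => h^-1 * (f (t + h) - f t)).
  apply/funext => h /=. have -> : h *: (1 : R) = h by exact: mulr1.
  by rewrite (addrC h t).
apply: DeriveDef.
  by rewrite /derivable E; apply/cvg_ex; exists d.
by rewrite /derive E; apply: cvg_lim.
Qed.

Lemma cvg_mder m n (U : R -> 'M[C]_(m, n)) t (M : 'M[C]_(m, n)) :
  (fun h : R => (rc h)^-1 *: (U (t + h) - U t)) @ 0^' --> M -> mder U t M.
Proof.
move=> UM i j; have [UM1 UM2] := mx_cvg_reim _ i j UM.
have scal (h : R) : (rc h)^-1 = rc h^-1 :> C by rewrite fmorphV.
split; apply: cvg_is_derive.
  apply: cvg_trans UM1; apply: near_eq_cvg; near=> h.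
  by rewrite !mxE scal reM /= mul0r subr0 reD reN.
apply: cvg_trans UM2; apply: near_eq_cvg; near=> h.
by rewrite !mxE scal imM /= mul0r addr0 imD imN.
Unshelve. all: by end_near.
Qed.

(** The derivative of [adjmx U *m U] is [adjmx U *m (adjmx G + G) *m U = 0], so this product keeps
    its initial value 1. *)
Lemma skew_flow_isometry n (U G : R -> 'M[C]_n) a b t :
  mcont `[a, b] U -> U a = 1%:M ->
  (forall s, s \in `]a, b[%R -> mder U s (G s *m U s) /\ adjmx (G s) = - G s) ->
  t \in `[a, b]%R -> adjmx (U t) *m U t = 1%:M.
Proof.
move=> cU Ua dU; rewrite in_itv /= => /andP[at_ tb].
have cY : mcont `[a, t] (fun s => adjmx (U s) *m U s).
  have cU' : mcont `[a, t] U.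
    move=> i j; have [c1 c2] := cU i j.
    by split; [apply: continuous_subspaceW c1|apply: continuous_subspaceW c2];
      move=> s /=; rewrite !in_itv /= => /andP[-> /le_trans->].
  exact: mcontM (mcont_adj cU') cU'.
have Y0 (v : 'cV[C]_n) : vnorm (adjmx (U t) *m U t *m v - adjmx (U a) *m U a *m v) <= 0.
  have -> : (0 : R) = cst 0 t - cst 0 a by rewrite subrr.
  apply: (@vmean_value R n (fun s => adjmx (U s) *m U s *m v) (cst 0) (cst 0) (cst 0) a t at_).
  - exact: mcontM cY (mcont_cst v _).
  - by move=> x; exact: cvg_cst.
  - move=> s; rewrite in_itv /= => /andP[as_ st].
    have [|dUs Gs] := dU s; first by rewrite in_itv /= as_ (lt_le_trans st).
    have := mderM (mderM (mder_adj dUs) dUs) (mder_cst v s).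
    rewrite mulmx0 addr0 adjmxM Gs mulmxN mulNmx mulmxA addNr mul0mx.
    exact.
  - by move=> s _; rewrite vnorm0.
apply/matrixP => i j.
(* Applied to a basis vector, the vanishing norm identifies the j-th column. *)
have /eqP := Y0 (delta_mx j 0); rewrite Ua adjmx1 !mul1mx.
move=> /eqP /(conj (vnorm_ge0 (adjmx (U t) *m U t *m delta_mx j 0 - delta_mx j 0))) /andP.
move=> /le_anti /esym /vnorm_eq0 /eqP; rewrite subr_eq0 => /eqP.
move=> /(congr1 (fun B : 'cV[C]_n => B i 0)); rewrite -colE !mxE => ->.
by rewrite eqxx andbT.
Qed.

Lemma unitary_exp_isometry n (P : 'M[C]_n) th : P *m adjmx P = 1%:M ->
  adjmx (unitary_exp P th) *m unitary_exp P th = 1%:M.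
Proof.
move=> PP; have PP' := mulmx1C PP.
rewrite /unitary_exp !adjmxM adjmxK adjmx_diag [adjmx P *m (_ *m P)]mulmxA (conj_diagM _ _ PP).
rewrite (_ : \row_j _ = const_mx 1); first by rewrite diag_const_mx mulmx1.
apply/matrixP => i j; rewrite !mxE mulrC.
apply: complex_eqP; rewrite ?reM ?imM reJ imJ.
  by rewrite mulrN opprK -!expr2 /= cos2Dsin2.
by rewrite mulrN addrC mulrC subrr.
Qed.

Lemma mder_unitary_exp n (G0 P : 'M[C]_n) th a t : skew_form G0 P th ->
  mder (fun s => unitary_exp P (fun k => (s - a) * th k)) t
    (G0 *m unitary_exp P (fun k => (t - a) * th k)).
Proof.
move=> [PP ->]; rewrite /unitary_exp (conj_diagM _ _ PP).
set d := diag_mx _; have := mderM (mderM (mder_cst (adjmx P) t)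
  (_ : mder (fun s => diag_mx (\row_k expi ((s - a) * th k))) t d)) (mder_cst P t).
rewrite mul0mx add0r mulmx0 addr0; apply => i j; rewrite !mxE.
case: (eqVneq i j) => [<-|ij]; last first.
  under eq_fun do rewrite !mxE (negbTE ij) mulr0n; rewrite mulr0n; exact: cder_cst.
under eq_fun do rewrite !mxE eqxx mulr1n; rewrite mulr1n.
have E s : (s - a) * th i = th i * s + - (th i * a) by ring.
by under eq_fun do rewrite E; rewrite E; exact: cder_expi.
Qed.

(** Interaction picture: with E the flow of [G0], the derivative of [adjmx E *m U] is
    [adjmx E *m (G - G0) *m U]. Since E and U are isometries, its norm is at most k(s - a), which
    integrates to k(b - a)^2 / 2. *)
Lemma evolution_vs_frozen n (U G : R -> 'M[C]_n) (G0 P : 'M[C]_n) th k a b :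
  a <= b -> mcont `[a, b] U -> U a = 1%:M ->
  (forall s, s \in `]a, b[%R -> mder U s (G s *m U s) /\ adjmx (G s) = - G s) ->
  skew_form G0 P th ->
  (forall s, s \in `]a, b[%R -> opbound (G s - G0) (k * (s - a))) ->
  opbound (U b - unitary_exp P (fun i => (b - a) * th i)) (k / 2 * (b - a) ^+ 2).
Proof.
move=> ab cU Ua dU G0f Gk v; have [PP G0E] := G0f.
have G0s : adjmx G0 = - G0.
  rewrite G0E !adjmxM adjmxK adjmx_diag mulmxA -mulNmx -mulmxN -raddfN.
  congr (_ *m diag_mx _ *m _); apply/matrixP => i j; rewrite !mxE.
  by apply: complex_eqP; rewrite /=; ring.
pose E s := unitary_exp P (fun i => (s - a) * th i).
have EE s : adjmx (E s) *m E s = 1%:M by exact: unitary_exp_isometry.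
have dE s : mder E s (G0 *m E s) by exact: mder_unitary_exp.
have cE : mcont `[a, b] E by move=> i j; apply: cder_ccont => s; exact: dE.
have Ea : E a = 1%:M.
  rewrite /E /unitary_exp (_ : \row_j _ = const_mx 1).
    by rewrite diag_const_mx mulmx1 (mulmx1C PP).
  by apply/matrixP => i j; rewrite !mxE subrr mul0r expi0.
rewrite -/(E b); clearbody E.
(* The antiderivative of the bound [k * (s - a) * vnorm v] that vanishes at [a]. *)
pose g (s : R) := (k / 2 * vnorm v) * ((s - a) * (s - a)).
have dg (s : R) : is_derive s 1 g (k * (s - a) * vnorm v).
  have d1 : is_derive s 1 (fun s => s - a) (1 + 0).
    exact: is_derive_add (is_derive_id s 1) (is_derive_cst (- a) s 1).
  apply: (is_derive_conv (is_derive_mul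
    (is_derive_cst (k / 2 * vnorm v : R) s 1) (is_derive_mul d1 d1))).
  by rewrite /cst; field.
have cg : {within `[a, b], continuous g}.
  apply: continuous_subspaceT => s; apply: differentiable_continuous.
  by apply/derivable1_diffP; case: (dg s).
have UE : (U b - E b) *m v =
   E b *m (adjmx (E b) *m U b *m v - adjmx (E a) *m U a *m v).
  rewrite Ea Ua adjmx1 !mul1mx mulmxBr !mulmxA (mulmx1C (EE b)) mul1mx mulmxBl.
  by [].
rewrite UE vnorm_isometry //.
rewrite [X in _ <= X](_ : _ = g b - g a); last by rewrite /g subrr !mulr0 subr0; ring.
apply: (@vmean_value R n (fun s => adjmx (E s) *m U s *m v)
  (fun s => adjmx (E s) *m (G s - G0) *m U s *m v) g (fun s => k * (s - a) * vnorm v) a b ab) => //.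
- exact: mcontM (mcontM (mcont_adj cE) cU) (mcont_cst v _).
- move=> s sab; have [dUs Gs] := dU s sab.
  have := mderM (mderM (mder_adj (dE s)) dUs) (mder_cst v s).
  rewrite mulmx0 addr0 adjmxM G0s mulmxN mulNmx -!mulmxA => dY.
  have <- // : (- (adjmx (E s) *m (G0 *m U s)) + adjmx (E s) *m (G s *m U s)) *m v =
    adjmx (E s) *m ((G s - G0) *m (U s *m v)).
  by rewrite mulmxDl mulNmx -!mulmxA [LHS]addrC -mulmxBr -mulmxBl.
- move=> s sab.
  rewrite -!mulmxA vnorm_isometry; last by rewrite adjmxK; exact: mulmx1C (EE s).
  apply: le_trans (Gk s sab _) _.
  rewrite vnorm_isometry // (skew_flow_isometry cU Ua dU) //.
  by apply: subset_itv_oo_cc.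
Qed.

End SkewEvolution.

(** * The kinetic matrix *)

Section KineticBound.
Variable R : realType.
Local Notation C := (Cc R).
Local Notation re z := (complex.Re ((z : C) : R[i])).

Lemma expiD (x y : R) : expi (x + y) = expi x * expi y.
Proof. by apply: complex_eqP; rewrite ?reM ?imM /= ?cosD ?sinD //; ring. Qed.

Lemma expiN (x : R) : expi (- x) = conjc (expi x) :> C.
Proof. by apply: complex_eqP; rewrite /= ?cosN ?sinN. Qed.

Lemma expi_mulrn (x : R) k : expi (k%:R * x) = expi x ^+ k.
Proof.
elim: k => [|k IH]; first by rewrite mul0r expi0.
by rewrite -add1n natrD mulrDl mul1r expiD IH exprS.
Qed.

Lemma expi_2pi k : expi (k%:R * (2 * pi)) = 1 :> C.
Proof.
rewrite expi_mulrn (_ : expi _ = 1) ?expr1n //.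
by apply: complex_eqP; rewrite /= mulrC mulr_natr ?cos2pi ?sin2pi.
Qed.

(** Since 1 - cos x = 2 sin^2(x/2), cos x = 1 would force sin(x/2) = 0, whereas x/2 lies strictly
    between 0 and pi. *)
Lemma expi_neq1 (x : R) : 0 < x -> x < 2 * pi -> expi x != 1 :> C.
Proof.
move=> x0 x2; apply/eqP => /(congr1 (fun z : C => re z)) /=.
have s0 : 0 < sin (x / 2) by rewrite sin_gt0_pi // ?divr_gt0 // ltr_pdivrMr // mulrC.
have -> : x = x / 2 + x / 2 by field.
rewrite cosD => h; have := cos2Dsin2 (x / 2).
by move: h s0; nra.
Qed.

Lemma conjcM (x y : C) : conjc (x * y) = (conjc x : C) * (conjc y : C).
Proof. exact: rmorphM. Qed.

Lemma conjcX (x : C) k : conjc (x ^+ k) = (conjc x : C) ^+ k.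
Proof. exact: rmorphXn. Qed.

(** Orthogonality of characters: an off-diagonal entry is a geometric sum of powers of some w with
    w^N = 1 and w != 1, hence zero. *)
Lemma Fmat_isometry N : (0 < N)%N -> adjmx (Fmat R N) *m Fmat R N = 1%:M.
Proof.
move=> N0; have Nr : (N%:R : R) != 0 by rewrite pnatr_eq0 -lt0n.
have Nc : (N%:R : C) != 0 by rewrite pnatr_eq0 -lt0n.
have sN : (rc (Num.sqrt N%:R))^-1 * (rc (Num.sqrt N%:R))^-1 = (N%:R)^-1 :> C.
  by rewrite -invfM -rmorphM -expr2 sqr_sqrtr // /= rmorph_nat.
pose w (x : R) : C := expi (2 * pi * x / N%:R).
have term (l m j : nat) :
    expi (2 * pi * j%:R * m%:R / N%:R) * conjc (expi (2 * pi * j%:R * l%:R / N%:R))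
    = w (m%:R - l%:R) ^+ j :> C.
  by rewrite -expiN -expiD /w -expi_mulrn; congr expi; field.
have wsum (l m : nat) : (l < m < N)%N -> \sum_(j < N) w (m%:R - l%:R) ^+ j = 0.
  move=> /andP[lm mN].
  have w1 : w (m%:R - l%:R) != 1.
    rewrite -natrB ?(ltnW lm) // /w; apply: expi_neq1.
      by rewrite divr_gt0 ?ltr0n // !mulr_gt0 ?pi_gt0 // ltr0n subn_gt0.
    rewrite ltr_pdivrMr ?ltr0n // ltr_pM2l ?mulr_gt0 ?pi_gt0 // ltr_nat.
    exact: leq_ltn_trans (leq_subr _ _) mN.
  have wN : w (m%:R - l%:R) ^+ N = 1.
    rewrite /w -expi_mulrn -natrB ?(ltnW lm) //.
    rewrite (_ : _ * _ = (m - l)%:R * (2 * pi)) ?expi_2pi //.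
    by move: ((m - l)%:R) => x; field.
  have := subrX1 (w (m%:R - l%:R)) N; rewrite wN subrr => /esym /eqP.
  by rewrite mulf_eq0 subr_eq0 (negbTE w1) => /eqP.
have entry l m : (adjmx (Fmat R N) *m Fmat R N) l m = (N%:R)^-1 * \sum_(j < N) w (m%:R - l%:R) ^+ j.
  rewrite !mxE big_distrr; apply: eq_bigr => j _; rewrite !mxE -sN -term.
  have cs : conjc (rc (Num.sqrt N%:R))^-1 = (rc (Num.sqrt N%:R))^-1 :> C.
    by rewrite fmorphV; congr (_^-1); apply: complex_eqP; rewrite /= ?oppr0.
  by rewrite conjcM cs /=; ring.
apply/matrixP => l m; rewrite entry mxE.
have [->|lm] := eqVneq l m.
  under eq_bigr do rewrite subrr /w mulr0 mul0r expi0 expr1n.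
  by rewrite sumr_const card_ord mulVf.
have [lt_lm|le_ml] := ltnP l m; first by rewrite wsum ?mulr0 // lt_lm ltn_ord.
have lt_ml : (m < l)%N by rewrite ltn_neqAle le_ml andbT eq_sym.
(* [wsum] covers l < m only; the opposite order follows by complex conjugation. *)
rewrite (eq_bigr (fun j : 'I_N => conjc (w (l%:R - m%:R) ^+ j) : C)); last first.
  move=> j _; rewrite conjcX /w -expiN; congr (expi _ ^+ _).
  by field.
rewrite -rmorph_sum wsum ?rmorph0 ?mulr0 //.
by rewrite lt_ml ltn_ord.
Qed.

Lemma Smat_isometry N : adjmx (Smat R N) *m Smat R N = 1%:M.
Proof.
rewrite adjmx_diag mulmx_diag (_ : \row_j _ = const_mx 1) ?diag_const_mx //.
apply/matrixP => i j; rewrite !mxE rmorphXn rmorphN rmorph1.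
by rewrite -exprMn mulrNN mulr1 expr1n.
Qed.

(** Eigenvalue bounds multiply under tensor products, and this one property yields both the norm
    bound and Hermiticity of each Kronecker term. *)
Definition real_diagonalizable n (M : 'M[C]_n) (c : R) :=
  exists (P : 'M[C]_n) (d : 'I_n -> R),
  [/\ P *m adjmx P = 1%:M, M = adjmx P *m diag_mx (\row_k rc (d k)) *m P
    & forall k, `|d k| <= c].

Lemma real_diagonalizable1 n : real_diagonalizable (1%:M : 'M[C]_n) 1.
Proof.
exists 1%:M, (fun _ => 1); split; last by move=> k; rewrite normr1.
  by rewrite adjmx1 mulmx1.
rewrite (_ : \row_k _ = const_mx 1); last by apply/matrixP => i j; rewrite !mxE.
by rewrite diag_const_mx adjmx1 !mulmx1.
Qed.

Lemma adjmx_tens m n p q (A : 'M[C]_(m, n)) (B : 'M[C]_(p, q)) :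
  adjmx (A *t B) = adjmx A *t adjmx B.
Proof. by apply/matrixP => i j; rewrite !mxE rmorphM. Qed.

Lemma tens_diag m n (d : 'I_m -> R) (e : 'I_n -> R) :
  diag_mx (\row_k rc (d k)) *t diag_mx (\row_k rc (e k)) =
  diag_mx (\row_k rc (d (mxtens_unindex k).1 * e (mxtens_unindex k).2)) :> 'M[C]_(m * n).
Proof.
apply/matrixP => i j; case: (mxtens_indexP i) => i1 i2; case: (mxtens_indexP j) => j1 j2.
rewrite tensmxE !mxE mxtens_indexK /= (can_eq (@mxtens_indexK m n)) xpair_eqE.
case: eqP => _; rewrite ?mulr0n ?mul0r //.
by case: eqP => _; rewrite ?mulr0n ?mulr0 // !mulr1n rmorphM.
Qed.

Lemma tens_id m n : (1%:M : 'M[C]_m) *t (1%:M : 'M[C]_n) = 1%:M.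
Proof.
apply/matrixP => i j; case: (mxtens_indexP i) => i1 i2; case: (mxtens_indexP j) => j1 j2.
rewrite tensmxE !mxE (can_eq (@mxtens_indexK m n)) xpair_eqE.
by case: eqP; case: eqP; rewrite /= ?mulr0 ?mul0r ?mulr1.
Qed.

Lemma real_diagonalizable_tens m n (A : 'M[C]_m) (B : 'M[C]_n) a b :
  real_diagonalizable A a -> real_diagonalizable B b ->
  real_diagonalizable (A *t B) (a * b).
Proof.
move=> [P [d [PP -> da]]] [Q [e [QQ -> eb]]].
exists (P *t Q), (fun k => d (mxtens_unindex k).1 * e (mxtens_unindex k).2); split.
- by rewrite adjmx_tens tensmx_mul PP QQ tens_id.
- by rewrite -tens_diag adjmx_tens !tensmx_mul.
- by move=> k; rewrite normrM ler_pM.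
Qed.

Lemma real_diagonalizable_cast m n (e : m = n) (A : 'M[C]_m) a :
  real_diagonalizable A a -> real_diagonalizable (castmx (e, e) A) a.
Proof. by case: n / e; rewrite castmx_id. Qed.

Lemma real_diagonalizable_bound n (A : 'M[C]_n) a :
  0 <= a -> real_diagonalizable A a -> opbound A a.
Proof.
move=> a0 [P [d [PP -> da]]]; apply: opbound_conj_diag => // i.
by rewrite mxE nrm_rc.
Qed.

Lemma adjmx_rc_diag n (d : 'I_n -> R) :
  adjmx (diag_mx (\row_k rc (d k)) : 'M[C]_n) = diag_mx (\row_k rc (d k)).
Proof.
rewrite adjmx_diag; congr diag_mx; apply/matrixP => i j; rewrite !mxE.
by apply: complex_eqP; rewrite /= ?oppr0.
Qed.

Lemma real_diagonalizable_herm n (A : 'M[C]_n) a : real_diagonalizable A a -> adjmx A = A.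
Proof.
move=> [P [d [PP -> da]]].
by rewrite !adjmxM adjmxK adjmx_rc_diag mulmxA.
Qed.

(** The columns of [Smat *m Fmat] are the eigenvectors; for 0 <= j < N the shifted index j - N/2 has
    absolute value at most N/2. *)
Lemma momentum_diagonalizable N (L : R) : (0 < N)%N ->
  real_diagonalizable (Smat R N *m Fmat R N *m DKmat N L *m adjmx (Fmat R N) *m adjmx (Smat R N))
    ((2 * pi / L) ^+ 2 * (N%:R / 2) ^+ 2).
Proof.
move=> N0; exists (adjmx (Smat R N *m Fmat R N)).
exists (fun j => (2 * pi / L) ^+ 2 * (j%:R - N%:R / 2) ^+ 2); split.
- rewrite adjmxK adjmxM mulmxA -[_ *m _ *m Smat R N]mulmxA Smat_isometry mulmx1.
  exact: Fmat_isometry.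
- by rewrite adjmxK adjmxM !mulmxA.
- move=> k /=; rewrite ger0_norm; last by apply: mulr_ge0; exact: sqr_ge0.
  rewrite ler_wpM2l ?sqr_ge0 //.
  rewrite -[leLHS]real_normK ?num_real // lerXn2r ?nnegrE ?divr_ge0 //.
  have kN : (k%:R : R) <= N%:R by rewrite ler_nat ltnW.
  have k0 : 0 <= (k%:R : R) by [].
  by rewrite ler_norml; apply/andP; split; lra.
Qed.

Lemma kron_term_diagonalizable d N (M : 'M[C]_N) c (j : 'I_d) : real_diagonalizable M c ->
  real_diagonalizable (castmx (kron_dim N j, kron_dim N j)
     (((1%:M : 'M[C]_(N ^ j)) *t M) *t (1%:M : 'M[C]_(N ^ (d.-1 - j))))) c.
Proof.
move=> Mc; apply: real_diagonalizable_cast; rewrite -[c]mul1r -[1 * c]mulr1.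
apply: real_diagonalizable_tens (real_diagonalizable1 _).
exact: real_diagonalizable_tens (real_diagonalizable1 _) Mc.
Qed.

(** Each of the [d] summands is bounded by (2 pi/L)^2 (N/2)^2 = pi^2 N^2 / L^2; the prefactor 1/2
    gives the constant. *)
Lemma Kmat_bound d N (L : R) : (0 < N)%N ->
  opbound (Kmat d N L) (d%:R * pi ^+ 2 * N%:R ^+ 2 / (2 * L ^+ 2)).
Proof.
move=> N0; have Mc := momentum_diagonalizable L N0.
set c := _ * _ in Mc; have c0 : 0 <= c by apply: mulr_ge0; exact: sqr_ge0.
have := opboundZ (rc (1 / 2)) (opbound_sum (index_enum 'I_d)
  (fun j => real_diagonalizable_bound c0 (kron_term_diagonalizable j Mc))).
apply: opbound_le; rewrite nrm_rc ger0_norm // sumr_const card_ord -[_ *+ d]mulr_natl /c.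
have -> : (2 * L ^+ 2)^-1 = 2^-1 * L^-1 ^+ 2 by rewrite invfM exprVn.
rewrite le_eqVlt; apply/orP; left; apply/eqP.
by move: (L^-1) => x; field.
Qed.

Lemma Kmat_herm d N (L : R) : (0 < N)%N -> adjmx (Kmat d N L) = Kmat d N L.
Proof.
move=> N0; have Mc := momentum_diagonalizable L N0.
rewrite adjmxZ adjmx_sum; congr (_ *: _).
  by apply: complex_eqP; rewrite /= ?oppr0.
by apply: eq_bigr => j _; exact: real_diagonalizable_herm (kron_term_diagonalizable j Mc).
Qed.

Lemma DV_bound d N (L : R) (f : 'rV[R]_d -> R) c :
  (forall a : 'I_(N ^ d), `|f (gridpt L a)| <= c) -> opbound (DV N L f) c.
Proof. by move=> fc; apply: opbound_diag => i; rewrite mxE nrm_rc. Qed.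

Lemma DV_herm d N (L : R) (f : 'rV[R]_d -> R) : adjmx (DV N L f) = DV N L f.
Proof. exact: adjmx_rc_diag. Qed.

End KineticBound.

(** * The error bound *)

Section Simulation.
Variable R : realType.
Local Notation C := (Cc R).

Lemma skew_imaginary n (K : 'M[C]_n) (x : R) : adjmx K = K ->
  adjmx ((iC * rc x) *: K) = - ((iC * rc x) *: K).
Proof.
move=> KK; rewrite adjmxZ KK -scaleNr; congr (_ *: _).
by apply: complex_eqP => /=; ring.
Qed.

Lemma skew_commutator n (K D : 'M[C]_n) : adjmx K = K -> adjmx D = D ->
  adjmx (K *m D - D *m K) = - (K *m D - D *m K).
Proof. by move=> KK DD; rewrite adjmxD adjmxN !adjmxM KK DD opprB. Qed.

Lemma opbound_commutator n (A B : 'M[C]_n) a b : 0 <= a -> 0 <= b ->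
  opbound A a -> opbound B b -> opbound (A *m B - B *m A) (2 * (a * b)).
Proof.
move=> a0 b0 Aa Bb.
have := opboundB (opboundM a0 Aa Bb) (opboundM b0 Bb Aa).
by apply: opbound_le; rewrite [b * a]mulrC mulr_natl mulr2n.
Qed.

Lemma mexp_imaginary_taylor n (K : 'M[C]_n) (x k : R) : 0 <= x -> 0 <= k ->
  adjmx K = K -> opbound K k ->
  taylor (mexp ((iC * rc x) *: K)) (expm_coef ((iC * rc x) *: K)) (x * k) /\
  taylor (mexp ((- iC * rc x) *: K)) (expm_coef (- ((iC * rc x) *: K))) (x * k).
Proof.
move=> x0 k0 KK Kk; have Ks := skew_imaginary x KK.
have Kb : opbound ((iC * rc x) *: K) (x * k).
  have := opboundZ (iC * rc x) Kk.
  by rewrite Normc.normcM nrm_iC nrm_rc mul1r ger0_norm.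
have -> : (- iC * rc x) *: K = - ((iC * rc x) *: K) by rewrite mulNr scaleNr.
have xk := mulr_ge0 x0 k0; split; first exact: mexp_taylor xk Ks Kb.
by apply: mexp_taylor xk _ (opboundN Kb); rewrite adjmxN Ks.
Qed.

Lemma simulation_bound n (K D0 : 'M[C]_n) (D U : R -> 'M[C]_n) (al be k v m t0 t1 : R) :
  0 <= al -> 0 <= be -> 0 <= k -> 0 <= v -> t0 <= t1 -> 2 * (al * be) = t1 - t0 ->
  adjmx K = K -> adjmx D0 = D0 -> (forall t, adjmx (D t) = D t) ->
  opbound K k -> opbound D0 v -> 0 <= m ->
  (forall t, t \in `]t0, t1[%R -> opbound (D t - D0) (m * (t - t0))) ->
  mcont `[t0, t1] U -> U t0 = 1%:M ->
  (forall t, t \in `]t0, t1[%R -> mder U t ((K *m D t - D t *m K) *m U t)) ->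
  opbound (U t1 - mexp ((iC * rc be) *: D0) *m mexp ((iC * rc al) *: K)
        *m mexp ((- iC * rc be) *: D0) *m mexp ((- iC * rc al) *: K)
        *m mexp ((- iC * rc be) *: D0) *m mexp ((- iC * rc al) *: K)
        *m mexp ((iC * rc be) *: D0) *m mexp ((iC * rc al) *: K))
    (k * m * (t1 - t0) ^+ 2 + 12 * (al * k + be * v) ^+ 4).
Proof.
move=> al0 be0 k0 v0 t01 albe KK DD0 DD Kk D0v m0 Dm cU U0 dU.
have [TA TA'] := mexp_imaginary_taylor al0 k0 KK Kk.
have [TB TB'] := mexp_imaginary_taylor be0 v0 DD0 D0v.
pose G0 := K *m D0 - D0 *m K.
have [P [th G0f]] := skew_formP (skew_commutator KK DD0).
have [PP G0E] := G0f.
(* The factor i^2 = -1 reverses the commutator, and 2 [al * be] is the elapsed time. *)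
have BAE : (((iC * rc be) *: D0) *m ((iC * rc al) *: K) -
    ((iC * rc al) *: K) *m ((iC * rc be) *: D0)) *+ 2 = rc (t1 - t0) *: G0.
  rewrite -!scalemxAl -!scalemxAr !scalerA [iC * rc al * _]mulrC -scalerBr.
  rewrite -opprB scalerN -scaleNr -scaler_nat scalerA; congr (_ *: _).
  by rewrite -albe; apply: complex_eqP => /=; ring.
have Gf : skew_form (rc (t1 - t0) *: G0) P (fun i => (t1 - t0) * th i).
  split; first exact: PP.
  rewrite [G0]G0E scalemxAl scalemxAr; congr (_ *m _ *m _).
  apply/matrixP => i j; rewrite !mxE; case: eqP => _; last by rewrite !mulr0n mulr0.
  by rewrite !mulr1n rmorphM mulrCA.
have TE : taylor (unitary_exp P (fun i => (t1 - t0) * th i))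
    (expm_coef ((((iC * rc be) *: D0) *m ((iC * rc al) *: K) -
      ((iC * rc al) *: K) *m ((iC * rc be) *: D0)) *+ 2)) (4 * ((al * k) * (be * v))).
  rewrite BAE; apply: unitary_exp_taylor Gf _; first by rewrite !mulr_ge0.
  have := opboundZ (rc (t1 - t0)) (opbound_commutator k0 v0 Kk D0v).
  rewrite nrm_rc ger0_norm ?subr_ge0 // -albe; apply: opbound_le.
  by rewrite (_ : 4 * _ = 2 * (al * be) * (2 * (k * v))) //; ring.
have EW := commutator_exp_bound TA TA' TB TB' TE.
have UE := @evolution_vs_frozen R n U (fun t => K *m D t - D t *m K) G0 P th (2 * (k * m))
  t0 t1 t01 cU U0 _ G0f _.
have -> : k * m * (t1 - t0) ^+ 2 = 2 * (k * m) / 2 * (t1 - t0) ^+ 2 by field.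
move: EW UE.
move: (mexp _) (mexp _) (mexp _) (mexp _) => eB eA eB' eA' EW UE.
have := opboundD (UE _ _) EW.
rewrite addrA subrK; apply.
  by move=> s st; split; [exact: dU|exact: skew_commutator].
move=> s st.
have -> : K *m D s - D s *m K - G0 = K *m (D s - D0) - (D s - D0) *m K.
  rewrite /G0 mulmxBr mulmxBl; move: (K *m D s) (D s *m K) (K *m D0) (D0 *m K) => x y z w.
  by apply/matrixP => i j; rewrite !mxE; ring.
have s0 : 0 <= s - t0 by move: st; rewrite in_itv /= subr_ge0 => /andP[/ltW].
have := opbound_commutator k0 (mulr_ge0 m0 s0) Kk (Dm s st).
by apply: opbound_le; rewrite !mulrA.
Qed.

Lemma gridpt_torus d N (L : R) (a : 'I_(N ^ d)) : (0 < N)%N -> 0 < L -> torus d L (gridpt L a).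
Proof.
move=> N0 L0 j; rewrite mxE; apply/andP; split.
  by rewrite mulr_ge0 // divr_ge0 // ltW.
rewrite mulrAC ltr_pdivrMr ?ltr0n // ltr_pM2l // ltr_nat.
exact: ltn_pmod.
Qed.

(** A version with real bounds [v] and [m] required only at grid points, the only values the
    matrices see; possibly infinite suprema are left to the final theorem. *)
Lemma theorem2_real (d N : nat) (L T t0 t1 v m : R)
  (V dV : R -> 'rV[R]_d -> R) (U : R -> 'M[C]_(N ^ d)) :
  (0 < d)%N -> 0 < L -> (0 < N)%N ->
  (forall x, torus d L x -> {within `[0, T], continuous (fun t => V t x)}) ->
  (forall x t, torus d L x -> t \in `]0, T[%R ->
     is_derive t 1 (fun s => V s x) (dV t x)) ->
  0 <= t0 -> t0 <= t1 -> t1 <= T -> 0 <= v -> 0 <= m ->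
  (forall a : 'I_(N ^ d), `|V t0 (gridpt L a)| <= v) ->
  (forall t (a : 'I_(N ^ d)), t \in `]t0, t1[%R -> `|dV t (gridpt L a)| <= m) ->
  U t0 = 1%:M -> {within `[t0, t1], continuous U} ->
  (forall t, t \in `]t0, t1[%R ->
     (fun h : R => (rc h)^-1 *: (U (t + h) - U t)) @ 0^' -->
       (- iC) *: (Hc N L (V t) *m U t)) ->
  let dt := t1 - t0 in
  let alpha := L / (pi * N%:R) * Num.sqrt (dt / d%:R) in
  let beta := pi * N%:R / (2 * L) * Num.sqrt (d%:R * dt) in
  let K := Kmat d N L in
  let D := DV N L (V t0) in
  let W := mexp ((iC * rc beta) *: D) *m mexp ((iC * rc alpha) *: K)
        *m mexp ((- iC * rc beta) *: D) *m mexp ((- iC * rc alpha) *: K)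
        *m mexp ((- iC * rc beta) *: D) *m mexp ((- iC * rc alpha) *: K)
        *m mexp ((iC * rc beta) *: D) *m mexp ((iC * rc alpha) *: K) in
  is_true (specnorm (U t1 - W) <=
     (3 * pi ^+ 4 / 4 * d%:R ^+ 2 * N%:R ^+ 4 / L ^+ 4 * (1 + v) ^+ 4
      + pi ^+ 2 / 2 * d%:R * N%:R ^+ 2 / L ^+ 2 * m) * dt ^+ 2).
Proof.
move=> d0 L0 N0 cV dVE t00 t01 t1T v0 m0 Vv dVm U0 cU dU dt alpha beta K D W.
have dr : 0 < d%:R :> R by rewrite ltr0n.
have Nr : 0 < N%:R :> R by rewrite ltr0n.
have pi0 : 0 < pi :> R := pi_gt0 R.
have dt0 : 0 <= dt by rewrite subr_ge0.
have al0 : 0 <= alpha by rewrite mulr_ge0 ?sqrtr_ge0 // divr_ge0 ?mulr_ge0 // ltW.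
have be0 : 0 <= beta by rewrite mulr_ge0 ?sqrtr_ge0 // divr_ge0 ?mulr_ge0 // ltW.
set k := d%:R * pi ^+ 2 * N%:R ^+ 2 / (2 * L ^+ 2) : R.
have k0 : 0 <= k by rewrite divr_ge0 ?mulr_ge0 ?exprn_ge0 // ltW.
have sq : Num.sqrt (d%:R * dt) = d%:R * Num.sqrt (dt / d%:R).
  rewrite -{2}[d%:R]ger0_norm ?ltW // -sqrtr_sqr -sqrtrM ?sqr_ge0 //.
  by congr Num.sqrt; field; rewrite gt_eqF.
have sq2 : Num.sqrt (dt / d%:R) ^+ 2 = dt / d%:R by rewrite sqr_sqrtr // divr_ge0 // ltW.
have albe : 2 * (alpha * beta) = t1 - t0.
  rewrite /alpha /beta sq -/dt.
  move: (Num.sqrt _) sq2 => r r2.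
  have -> : dt = d%:R * r ^+ 2 by rewrite r2; field; rewrite gt_eqF.
  by move: (pi : R) pi0 => q q0; field; rewrite !gt_eqF.
(* The choice of [alpha] and [beta] balances the two exponents: [alpha * k + beta * v] becomes
   [beta * (1 + v)], and 12 [beta ^+ 4] carries the constant 3 pi^4 / 4. *)
have alk : alpha * k = beta.
  rewrite /alpha /beta /k sq; move: (Num.sqrt _) => r.
  by move: (pi : R) pi0 => q q0; field; rewrite !gt_eqF.
have be4 : beta ^+ 4 = pi ^+ 4 * N%:R ^+ 4 / (16 * L ^+ 4) * d%:R ^+ 2 * dt ^+ 2.
  rewrite /beta exprMn (_ : Num.sqrt _ ^+ 4 = (Num.sqrt (d%:R * dt) ^+ 2) ^+ 2).
    rewrite sqr_sqrtr ?mulr_ge0 // ?ltW //.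
    by move: (pi : R) pi0 => q q0; field; rewrite !gt_eqF.
  by rewrite -exprM.
(* The difference is diagonal, so the mean value theorem is applied at each grid point. Only points
   strictly between [t0] and [t] occur, which lie in the open interval where [V] is differentiable
   even if [t0 = 0]. *)
have Dm t : t \in `]t0, t1[%R -> opbound (DV N L (V t) - D) (m * (t - t0)).
  rewrite in_itv /= => /andP[t0t tt1].
  have -> : DV N L (V t) - D = DV N L (fun x => V t x - V t0 x).
    rewrite /D /DV -raddfB; congr diag_mx.
    by apply/matrixP => i j; rewrite !mxE rmorphB.
  apply: DV_bound => a.
  have ga : torus d L (gridpt L a) by exact: gridpt_torus.
  have dVx s : s \in `]t0, t[%R -> is_derive s 1 (fun s => V s (gridpt L a)) (dV s (gridpt L a)).
    rewrite in_itv /= => /andP[t0s st].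
    apply: (dVE _ _ ga); rewrite in_itv /= (le_lt_trans t00 t0s) /=.
    exact: lt_le_trans st (le_trans (ltW tt1) t1T).
  have cVx : {within `[t0, t], continuous (fun s => V s (gridpt L a))}.
    apply: continuous_subspaceW (cV _ ga) => s /=; rewrite !in_itv /= => /andP[t0s st].
    by rewrite (le_trans t00 t0s) (le_trans st (le_trans (ltW tt1) t1T)).
  have [c] := MVT t0t dVx cVx.
  rewrite in_itv /= => /andP[t0c ct] ->.
  rewrite normrM [X in _ * X]ger0_norm ?subr_ge0 ?(ltW t0t) //.
  rewrite ler_wpM2r ?subr_ge0 ?(ltW t0t) // dVm // in_itv /= t0c.
  exact: lt_trans ct tt1.
have dU' t : t \in `]t0, t1[%R ->
    mder U t ((K *m DV N L (V t) - DV N L (V t) *m K) *m U t).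
  (* The factor -i in the evolution cancels the i in [Hc], leaving the plain commutator as
     generator. *)
  move=> tt; apply: cvg_mder; have := dU t tt.
  rewrite [Hc _ _ _]/Hc -scalemxAl scalerA.
  by rewrite (_ : - iC * iC = 1) ?scale1r //; apply: complex_eqP => /=; ring.
have nd : (0 < N ^ d)%N by rewrite expn_gt0 N0.
have := specnorm_le nd (@simulation_bound (N ^ d) K D (fun t => DV N L (V t)) U
  alpha beta k v m t0 t1
  al0 be0 k0 v0 t01 albe (@Kmat_herm R d N L N0) (@DV_herm R d N L _) (fun t => @DV_herm R d N L _)
  (@Kmat_bound R d N L N0) (DV_bound Vv) m0 Dm (continuous_mcont cU) U0 dU').
rewrite -/W => W_le; apply: le_trans W_le _.
rewrite alk -/dt (_ : beta + beta * v = beta * (1 + v)); last by ring.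
rewrite exprMn be4 le_eqVlt; apply/orP; left; apply/eqP.
by rewrite /k; move: (pi : R) => q; field; rewrite gt_eqF.
Qed.

End Simulation.

Lemma linf_ge (R : realType) d (L : R) (f : 'rV[R]_d -> R) x :
  torus d L x -> ((`|f x|)%:E <= linf L f)%E.
Proof. by move=> Lx; apply: ereal_sup_ubound; exists x. Qed.

Lemma linf_ge0 (R : realType) d (L : R) (f : 'rV[R]_d -> R) : 0 < L -> (0 <= linf L f)%E.
Proof.
move=> L0; have T0 : torus d L 0 by move=> j; rewrite mxE lexx.
by apply: le_trans (linf_ge f T0); rewrite lee_fin.
Qed.

Unset Implicit Arguments.

Theorem theorem2 (R : realType) (d N p : nat) (L T t0 t1 : R)
  (V dV : R -> 'rV[R]_d -> R) (U : R -> 'M[Cc R]_(N ^ d)) :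
  (0 < d)%N -> 0 < L -> (2 <= N)%N -> N = (2 ^ p)%N -> 0 < T ->
  (* t |-> V_t(x) is continuously differentiable on [0,T], with derivative dV *)
  (forall x, torus d L x -> {within `[0, T], continuous (fun t => V t x)}) ->
  (forall x, torus d L x -> {within `[0, T], continuous (fun t => dV t x)}) ->
  (forall x t, torus d L x -> t \in `]0, T[ ->
     is_derive t 1 (fun s => V s x) (dV t x)) ->
  0 <= t0 -> t0 <= t1 -> t1 <= T ->
  (* U(., t0) is the time-ordered evolution: U(t0) = I, dU/dt = -i H^c_t U *)
  U t0 = 1%:M ->
  {within `[t0, t1], continuous U} ->
  (forall t, t \in `]t0, t1[ ->
     (fun h : R => (rc h)^-1 *: (U (t + h) - U t)) @ 0^' -->
       (- iC) *: (Hc N L (V t) *m U t)) ->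
  let dt := t1 - t0 in
  let alpha := L / (pi * N%:R) * Num.sqrt (dt / d%:R) in
  let beta := pi * N%:R / (2 * L) * Num.sqrt (d%:R * dt) in
  let K := Kmat d N L in
  let D := DV N L (V t0) in
  let W := mexp ((iC * rc beta) *: D) *m mexp ((iC * rc alpha) *: K)
        *m mexp ((- iC * rc beta) *: D) *m mexp ((- iC * rc alpha) *: K)
        *m mexp ((- iC * rc beta) *: D) *m mexp ((- iC * rc alpha) *: K)
        *m mexp ((iC * rc beta) *: D) *m mexp ((iC * rc alpha) *: K) in
  ((specnorm (U t1 - W))%:E <=
     ((3 * pi ^+ 4 / 4 * d%:R ^+ 2 * N%:R ^+ 4 / L ^+ 4)%:E
        * (1 + linf L (V t0)) ^+ 4
      + (pi ^+ 2 / 2 * d%:R * N%:R ^+ 2 / L ^+ 2)%:E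
        * ereal_sup [set linf L (dV t) | t in `[t0, t1]])
     * (dt ^+ 2)%:E)%E.
Proof.
move=> d0 L0 N2 _ _ cV _ dVE t00 t01 t1T U0 cU dU; cbv zeta.
have N0 : (0 < N)%N by exact: ltn_trans N2.
have dVE' x t : torus d L x -> t \in `]0, T[%R -> is_derive t 1 (fun s => V s x) (dV t x).
  by move=> xL tT; apply: dVE => //; exact: mem_set.
have dU' t : t \in `]t0, t1[%R ->
    (fun h : R => (rc h)^-1 *: (U (t + h) - U t)) @ 0^' -->
       (- iC) *: (Hc N L (V t) *m U t).
  by move=> tt; apply: dU; exact: mem_set.
set e := specnorm _.
set c1 := 3 * pi ^+ 4 / 4 * d%:R ^+ 2 * N%:R ^+ 4 / L ^+ 4.
set c2 := pi ^+ 2 / 2 * d%:R * N%:R ^+ 2 / L ^+ 2.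
have real_bound v m : 0 <= v -> 0 <= m ->
    (forall a : 'I_(N ^ d), `|V t0 (gridpt L a)| <= v) ->
    (forall t (a : 'I_(N ^ d)), t \in `]t0, t1[%R -> `|dV t (gridpt L a)| <= m) ->
    e <= (c1 * (1 + v) ^+ 4 + c2 * m) * (t1 - t0) ^+ 2.
  by move=> v0 m0 Vv dVm; exact: (theorem2_real d0 L0 N0 cV dVE' t00 t01 t1T
    v0 m0 Vv dVm U0 cU dU').
clearbody e.
have pi0 : 0 < pi :> R := pi_gt0 R.
have dr : 0 < d%:R :> R by rewrite ltr0n.
have Nr : 0 < N%:R :> R by rewrite ltr0n.
have c1_gt0 : 0 < c1 by rewrite divr_gt0 ?mulr_gt0 ?exprn_gt0 ?invr_gt0.
have c2_gt0 : 0 < c2 by rewrite divr_gt0 ?mulr_gt0 ?exprn_gt0 ?invr_gt0.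
(* If t0 = t1 the right-hand side is 0 even when a supremum is +oo, since +oo * 0 = 0 in
   the extended reals; the grid being finite, a finite bound on V_{t0} is available. *)
have [t01E|t_neq] := eqVneq t0 t1.
  pose v := \sum_(a < N ^ d) `|V t0 (gridpt L a)|.
  have := real_bound v 0 (sumr_ge0 _ (fun a _ => normr_ge0 _)) (lexx _).
  rewrite t01E subrr expr0n /= mulr0 mule0 lee_fin; apply => //.
  - by move=> a; rewrite /v -t01E (bigD1 a) //= lerDl sumr_ge0.
  - by move=> t a; rewrite in_itv /= => /andP[/lt_trans h /h]; rewrite ltxx.
have dt_gt0 : (0 < ((t1 - t0) ^+ 2)%:E :> \bar R)%E.
  by rewrite lte_fin exprn_gt0 // subr_gt0 lt_neqAle t_neq.
have v_ge0 := linf_ge0 (V t0) L0.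
have m_ge t : t \in `[t0, t1]%R ->
    (linf L (dV t) <= ereal_sup [set linf L (dV t) | t in `[t0, t1]])%E.
  by move=> tt; apply: ereal_sup_ubound; exists t.
have m_ge0 : (0 <= ereal_sup [set linf L (dV t) | t in `[t0, t1]])%E.
  by apply: le_trans (linf_ge0 (dV t0) L0) (m_ge _ _); rewrite in_itv /= lexx.
have Vv a := linf_ge (V t0) (gridpt_torus a N0 L0).
have dVm t (a : 'I_(N ^ d)) : t \in `]t0, t1[%R ->
    ((`|dV t (gridpt L a)|)%:E <= ereal_sup [set linf L (dV t) | t in `[t0, t1]])%E.
  move=> tt; apply: (le_trans (linf_ge (dV t) (gridpt_torus a N0 L0))).
  by apply: m_ge; exact: subset_itv_oo_cc tt.
(* Both suprema are nonnegative, hence finite or +oo. As [c1], [c2] and the squared time step are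
   positive, a single +oo makes the right-hand side +oo. *)
move: (linf L (V t0)) (ereal_sup _) v_ge0 m_ge0 Vv dVm {m_ge}.
case=> [v| |//] [m| |//] v_ge0 m_ge0 Vv dVm.
- have ->: ((1 + v%:E) ^+ 4 = ((1 + v) ^+ 4)%:E :> \bar R)%E by rewrite EFin_expe.
  rewrite -!EFinM lee_fin.
  by apply: (real_bound v m) => // [a|t a /dVm]; rewrite -lee_fin.
- rewrite (gt0_muley (x := c2%:E)) ?lte_fin // addey.
    by rewrite gt0_mulye // leey.
  by rewrite -EFin_expe -EFinM.
- have -> : ((1 + +oo) ^+ 4 = +oo :> \bar R)%E by rewrite addey // !expeS expe0 mule1 !mulyy.
  rewrite (gt0_muley (x := c1%:E)) ?lte_fin // addye.
    by rewrite gt0_mulye // leey.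
  by rewrite -EFinM.
- have -> : ((1 + +oo) ^+ 4 = +oo :> \bar R)%E by rewrite addey // !expeS expe0 mule1 !mulyy.
  rewrite (gt0_muley (x := c1%:E)) ?lte_fin // (gt0_muley (x := c2%:E)) ?lte_fin // addye //.
  by rewrite gt0_mulye // leey.
Qed.
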